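(* There exist universal constants $c, C, c', C' > 0$ such that the following holds. Let $M \in \mathbb{Z}^+$, and let $G$ be a connected $n$-vertex, $d$-regular $\lambda$-expander with $\lambda \le d/5 \le cn$, where $$M \le \min\left\{ c\,\frac{d^{3/2}}{\lambda \log d},\ (\log n)^C \right\}.$$ Fix $v_0 \in V(G)$, and let $f$ be chosen uniformly at random from $\mathrm{Lip}_{v_0}(G;M)$. Then $$\mathbb{P}\left( R(f) \ge C' M\, \frac{\log\log (n)}{\log(d/\lambda)} + 2(M+1) \right) \le n^{-c'}.$$ Furthermore, for every $v \in V(G)$, we have $$\mathrm{Var}(f(v)) = O\left( \left( M \left\lceil \frac{\log (M)}{\log(d/2\lambda)} \right\rceil \right)^2 \right),$$ where the implicit constant is universal and $d/2\lambda$ means $d/(2\lambda)$.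
   Context: All graphs are finite and simple; $\log$ denotes $\log_2$. By adjusting the constants, $d$ and $n$ are assumed to be large. An $n$-vertex $d$-regular graph $G$ is called a $\lambda$-expander if for all $S, T \subseteq V(G)$, $$\left| e(S,T) - \frac{d}{n}|S||T| \right| \le \lambda \sqrt{|S||T|},$$ where $e(S,T)$ is the number of edges with one endpoint in $S$ and the other in $T$, counted twice if both endpoints lie in $S \cap T$. For $v_0 \in V(G)$, $\mathrm{Lip}_{v_0}(G;M)$ is the set of all $f : V(G) \to \mathbb{Z}$ with $f(v_0) = 0$ and $|f(u)-f(v)| \le M$ for every $\{u,v\} \in E(G)$; it is finite because $G$ is finite and connected. The range of $f : V(G) \to \mathbb{Z}$ is $R(f) := \max_{v \in V(G)} f(v) - \min_{v \in V(G)} f(v) + 1$.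
   Formalization: In the variance bound the factor ⌈log(M)/log(d/2λ)⌉ is replaced by max(1, ⌈log(M)/log(d/2λ)⌉); this differs only for M = 1, where the printed bound would give Var(f(v)) = 0, which is false for neighbours of v_0. *)

(* Defs.v *)
From HB Require Import structures.
From mathcomp Require Import all_boot all_order all_algebra.
From mathcomp Require Import finmap.
From mathcomp Require Import all_classical all_reals all_analysis.

Set Implicit Arguments.
Unset Strict Implicit.
Unset Printing Implicit Defensive.

Import Order.TTheory GRing.Theory Num.Theory.

Local Open Scope classical_set_scope.
Local Open Scope ring_scope.

Record sgraph := SGraph {
  vertex :> finType;
  adj : rel vertex;
  adj_sym : symmetric adj;
  adj_irrefl : irreflexive adj }.

Definition connected_graph (G : sgraph) : Prop :=
  forall u v : G, connect (@adj G) u v.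

Definition regular_graph (G : sgraph) (d : nat) : Prop :=
  forall v : G, #|[set u | adj v u]%SET| = d.

(* Ordered pairs are counted, so that an edge with both endpoints in the
   intersection of S and T contributes 2. *)
Definition e_between (G : sgraph) (S T : {set G}) : nat :=
  #|[set p : G * G | [&& p.1 \in S, p.2 \in T & adj p.1 p.2]]%SET|.

Definition expander (R : realType) (G : sgraph) (n d : nat) (lambda : R) : Prop :=
  [/\ #|G| = n,
      regular_graph G d
    & forall S T : {set G},
        `|(e_between S T)%:R - d%:R / n%:R * #|S|%:R * #|T|%:R|
          <= lambda * Num.sqrt (#|S|%:R * #|T|%:R) ].

Definition Lip (G : sgraph) (v0 : G) (M : nat) : set {ffun G -> int} :=
  [set f | f v0 = 0 /\ forall u v : G, adj u v -> `|f u - f v| <= M%:Z].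

(* A finite maximum over int needs a starting value; f v0 is itself one of the
   values of f, so the result does not depend on v0. *)
Definition lip_range (G : sgraph) (v0 : G) (f : {ffun G -> int}) : int :=
  \big[Order.max/f v0]_(v : G) f v - \big[Order.min/f v0]_(v : G) f v + 1.

(* X is a uniformly random element of the finite set A.  As X takes all of its
   values in A, measurability of the fibres makes X measurable for the
   discrete sigma-algebra. *)
Definition uniformly_distributed d (Omega : measurableType d) (R : realType)
    (P : probability Omega R) (T : choiceType) (A : set T) (X : Omega -> T) : Prop :=
  [/\ finite_set A,
      forall w, A (X w),
      forall a, A a -> measurable (X @^-1` [set a])
    & forall a, A a -> P (X @^-1` [set a]) = ((#|` fset_set A|%:R)^-1)%:E ].

Definition log2 (R : realType) (x : R) : R := ln x / ln 2.

Lemma finite_Lip (G : sgraph) (v0 : G) (M : nat) :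
  connected_graph G -> finite_set (Lip v0 M).
Proof.
move=> conn.
have bound : forall f, Lip v0 M f -> forall v, (absz (f v) < (M * #|G|).+1)%N.
  move=> f [f0 fL] v; have /connectP[p pth ->] := conn v0 v.
  have [p' pth' up' _] := shortenP pth.
  have sz : (size p' <= #|G|)%N.
    by apply: leq_trans (max_card (mem (v0 :: p'))); rewrite (card_uniqP up') /=.
  rewrite ltnS; apply: leq_trans (leq_mul (leqnn M) sz).
  rewrite -lez_nat abszE -[X in `|X|]subr0 -f0.
  elim: p' v0 pth' {f0 up' sz pth conn p v} => [|x s IH] y /=; first by rewrite subrr normr0 muln0.
  case/andP=> yx sx; rewrite mulnS PoszD [leRHS]addrC.
  have -> : f (last x s) - f y = (f (last x s) - f x) + (f x - f y) by rewrite addrA subrK.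
  by apply: le_trans (ler_normD _ _) (lerD (IH _ sx) _); rewrite distrC fL.
pose N := (M * #|G|).+1.
pose F (g : {ffun G -> bool * 'I_N}) : {ffun G -> int} :=
  [ffun v => (-1) ^+ (g v).1 * ((g v).2 : nat)%:Z].
apply: (@sub_finite_set _ _ (F @` setT)); last exact: finite_image.
move=> f Lf; exists [ffun v => (f v < 0, Ordinal (bound f Lf v))] => //.
by apply/ffunP=> v; rewrite !ffunE /= abszE; rewrite -intEsign.
Qed.

(* Main.v *)
(** Proof idea.  Call a set A spreading if some T in A with
    d|T| <= 100|N(T)| satisfies |N(T)| >= 11n/20.  If A is not spreading, a
    maximal T in A with d|T| <= 100|N(T)| has A inside its hull (the vertices
    with almost all neighbours in N(T)), and expander mixing gives
    121|hull T| <= 25|N(T)|; so A is described, at a cost of only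
    |N(T)| log d / d, up to a set much smaller than N(T).

    Translate f so that the sets {f < 0} and {f > M} do not spread.  Let Y be
    the component, for links of length at most 3, of a vertex v in the set where
    f leaves [0, M].  On each side and for every dyadic depth 2^i, let T_i be
    such a sparse certificate for the vertices of Y of depth at least 2^i.  Let
    rho(u) and tau(u) be the largest 2^i with u in hull T_i, respectively
    u in N(T_i), summed over both sides.  Given the certificates, f(u) takes at
    most M + 1 + 2 rho(u) - tau(u) values, whereas f can be resampled in [0, M]
    on the whole region covered by hulls and neighbourhoods.  Since
    log(1 + x) <= x, the certificates occur with probability at most
    exp(sum (2 rho - tau) / (M + 1)) <= exp(- gain / (12(M + 1))), where
    gain = sum 2^i |N(T_i)|.  As M <= c d / log d, this beats the number of
    connected families of certificates.  Depth r at v forces gain of order r d,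
    and depth more than jM forces gain >= (d / lambda)^j.

    If f has no such translate, shift it to the last position where {f < 0} does
    not spread.  Then {f <= 0} and {f >= M + r} spread for some r >= 1, each
    confining 11/20 of the vertices, and the total number of available values
    drops by r n / 10; such f have probability exp(- c n / M). *)

Require Import Defs.
From HB Require Import structures.
From mathcomp Require Import all_boot all_order all_algebra.
From mathcomp Require Import finmap.
From mathcomp Require Import all_classical all_reals all_analysis.
From mathcomp Require Import zify ring lra.

Set Implicit Arguments.
Unset Strict Implicit.
Unset Printing Implicit Defensive.

Import Order.TTheory GRing.Theory Num.Theory.

(** * Uniform laws on finite sets *)

Section UniformLaw.

Local Open Scope classical_set_scope.
Local Open Scope ring_scope.

Variables (disp : measure_display) (Omega : measurableType disp) (R : realType).
Variables (P : probability Omega R) (T : choiceType) (A : set T) (X : Omega -> T).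
Hypothesis uX : uniformly_distributed P A X.

Local Notation s := (enum_fset (fset_set A)).
Local Notation N := ((size s)%:R : R).

Lemma uniform_fibre_measurable a : measurable (X @^-1` [set a]).
Proof.
have [fA XA mX _] := uX; have [/mX//|nA] := pselect (A a).
rewrite (_ : _ @^-1` _ = set0) // -subset0 => w /= Xw.
by apply: nA; rewrite -Xw; exact: XA.
Qed.

(** [phi (X w)] is a finite sum of constants times indicators of fibres, each fibre having mass 1 /
    N. *)
Lemma uniform_integral (phi : T -> R) :
  (\int[P]_w (phi (X w))%:E = ((\sum_(a <- s) phi a) / N)%:E)%E.
Proof.
have [fA XA _ PX] := uX.
pose f a w : \bar R := (phi a * \1_(X @^-1` [set a]) w)%:E.
have sA a : (a \in s) = (a \in A) by rewrite -(in_fset_set fA).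
have fE w : (phi (X w))%:E = (\sum_(a <- s) f a w)%E.
  rewrite sumEFin (bigD1_seq (X w)) /=; first last.
  - exact: fset_uniq.
  - by rewrite sA in_setE; exact: XA.
  rewrite indicE mem_set //= mulr1 big1 ?addr0 // => a aX.
  by rewrite indicE memNset ?mulr0 //= => e; rewrite e eqxx in aX.
have intf a : P.-integrable setT (f a).
  rewrite /f; under eq_fun do rewrite EFinM.
  apply: integrableZl => //; apply: integrable_indic => //.
    exact: uniform_fibre_measurable.
under eq_integral do rewrite fE.
rewrite integral_sum // mulr_suml -sumEFin big_seq [RHS]big_seq.
apply: eq_bigr => a; rewrite sA in_setE => Aa.
rewrite /f; under eq_integral do rewrite EFinM.
rewrite integralZl //; last by apply: integrable_indic; exact: uniform_fibre_measurable.
rewrite integral_indic ?setIT //; last exact: uniform_fibre_measurable.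
by rewrite [X in (_ * X)%E](_ : _ = (N^-1)%:E) //; exact: PX.
Qed.

Lemma uniform_probability (E : pred T) :
  P [set w | E (X w)] = ((count E s)%:R / N)%:E.
Proof.
have [fA XA _ PX] := uX.
pose C := [set w | E (X w)].
have mC : measurable C.
  rewrite (_ : C = \bigcup_(a in A `&` E) (X @^-1` [set a])).
    apply: fin_bigcup_measurable => [|a _]; last exact: uniform_fibre_measurable.
    by apply: sub_finite_set fA => a [].
  apply/seteqP; split=> [w Ew|w [a [_ Ea] /= Xw]]; last by rewrite /C /= Xw.
  by exists (X w) => //; split=> //; exact: XA.
rewrite -/C -[C]setIT -integral_indic //.
rewrite -sum1_count natr_sum big_mkcond /= -(uniform_integral (fun a => if E a then 1 else 0)).
apply: eq_integral => w _; rewrite indicE; case: ifPn => Ew.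
  by rewrite mem_set.
by rewrite memNset //; apply/negP.
Qed.

Lemma uniform_variance_le (phi : T -> R) :
  ('V_P[fun w => phi (X w)] <= ((\sum_(a <- s) phi a ^+ 2) / N)%:E)%E.
Proof.
(* [Omega] has a point because P has total mass 1, and [X] sends it into [A]. *)
have N0 : 0 < N.
  have [fA XA _ _] := uX.
  have [w _] : exists w : Omega, True.
    have [P0|/set0P[w _]] := eqVneq ([set: Omega]) set0; last by exists w.
    have := probability_setT P; rewrite P0 measure0 => /eqP.
    by rewrite eqe eq_sym oner_eq0.
  rewrite ltr0n lt0n size_eq0; apply/eqP => s0.
  have : X w \in A by rewrite in_setE; exact: XA.
  by rewrite -(in_fset_set fA) -[_ \in fset_set A]/(X w \in s) s0.
rewrite /variance covariance.unlock !expectation.unlock uniform_integral /=.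
set m := (\sum_(a <- s) phi a) / N.
have -> : (\int[P]_w ((((fun w => phi (X w)) \- cst m) * ((fun w => phi (X w)) \- cst m)) w)%:E
    = ((\sum_(a <- s) (phi a - m) ^+ 2) / N)%:E)%E.
  exact: (uniform_integral (fun a => (phi a - m) ^+ 2)).
rewrite lee_fin ler_pM2r ?invr_gt0 //.
have -> : \sum_(a <- s) (phi a - m) ^+ 2 = \sum_(a <- s) phi a ^+ 2 - N * m ^+ 2.
  transitivity (\sum_(a <- s) (phi a ^+ 2 - (2 * m) * phi a + m ^+ 2)).
    by apply: eq_bigr => a _; ring.
  rewrite big_split /= sumrB -mulr_sumr big_const_seq count_predT iter_addr addr0 -mulr_natl -/N.
  have -> : \sum_(a <- s) phi a = N * m by rewrite /m mulrC divfK ?gt_eqF.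
  by ring.
by rewrite gerBl mulr_ge0 ?sqr_ge0 // ltW.
Qed.

End UniformLaw.

From mathcomp Require Import fintype finset.

(** * Neighbourhoods and sparse certificates *)

Section Neighbourhoods.

Variable G : sgraph.
Implicit Types (u v w : G) (A B S T F : {set G}).

Definition nbr u : {set G} := [set w | adj u w].
Definition nbrs A : {set G} := \bigcup_(u in A) nbr u.

Lemma in_nbr u w : (w \in nbr u) = adj u w.
Proof. by rewrite inE. Qed.

Lemma nbrsP A w : reflect (exists2 u, u \in A & adj u w) (w \in nbrs A).
Proof.
apply: (iffP bigcupP) => [[u uA]|[u uA uw]]; first by rewrite in_nbr => uw; exists u.
by exists u; rewrite ?in_nbr.
Qed.

Lemma nbrsS A B : A \subset B -> nbrs A \subset nbrs B.
Proof.
move=> /subsetP AB; apply/subsetP => w /nbrsP[u uA uw]; apply/nbrsP.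
by exists u => //; apply: AB.
Qed.

Lemma nbrs1 u : nbrs [set u] = nbr u.
Proof. by rewrite /nbrs big_set1. Qed.

Lemma nbrsU A B : nbrs (A :|: B) = nbrs A :|: nbrs B.
Proof. exact: bigcup_setU. Qed.

Lemma sub_nbrs u A : u \in A -> nbr u \subset nbrs A.
Proof. by move=> uA; rewrite -nbrs1; apply: nbrsS; rewrite sub1set. Qed.

Fixpoint gball (m : nat) u : {set G} :=
  if m is m'.+1 then gball m' u :|: nbrs (gball m' u) else [set u].

Lemma gball_self m u : u \in gball m u.
Proof. by elim: m => [|m IH] /=; rewrite !inE ?IH. Qed.

Lemma gballS m u : gball m u \subset gball m.+1 u.
Proof. exact: subsetUl. Qed.

Lemma gball_leq m m' u : m <= m' -> gball m u \subset gball m' u.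
Proof.
move=> /subnKC <-; elim: (m' - m) => [|k IH]; first by rewrite addn0.
by rewrite addnS; apply: subset_trans IH (gballS _ _).
Qed.

Lemma gball_step m u v w : v \in gball m u -> adj v w -> w \in gball m.+1 u.
Proof.
by move=> vm vw /=; rewrite inE; apply/orP; right; apply/nbrsP; exists v.
Qed.

Lemma gball_trans m m' u v w :
  v \in gball m u -> w \in gball m' v -> w \in gball (m + m') u.
Proof.
move=> vu; elim: m' w => [|m' IH] w /=; first by rewrite inE addn0 => /eqP ->.
rewrite inE addnS => /orP[/IH|/nbrsP[x /IH xb xw]]; last exact: gball_step xb xw.
exact: (subsetP (gballS _ _)).
Qed.

Lemma gball_sym m u v : v \in gball m u -> u \in gball m v.
Proof.
elim: m v => [|m IH] v /=; first by rewrite !inE eq_sym.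
rewrite inE => /orP[/IH ub|/nbrsP[x /IH ub xv]].
  exact: (subsetP (gballS _ _)).
have xv1 : x \in gball 1 v by apply: (@gball_step 0 v v); rewrite ?inE // adj_sym.
by have := gball_trans xv1 ub.
Qed.

Lemma card_nbrs_le d A : regular_graph G d -> #|nbrs A| <= #|A| * d.
Proof.
move=> reg; rewrite /nbrs; apply: (@leq_trans (\sum_(u in A) #|nbr u|)).
  elim/big_rec2: _ => [|u m B _ IH]; first by rewrite cards0.
  by apply: leq_trans (leq_card_setU _ _) _; rewrite leq_add2l.
by rewrite (eq_bigr (fun=> d)) ?sum_nat_const // => u _; apply: reg.
Qed.

Lemma card_gball d m u : regular_graph G d -> #|gball m u| <= d.+1 ^ m.
Proof.
move=> reg; elim: m => [|m IH] /=; first by rewrite cards1.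
apply: leq_trans (leq_card_setU _ _) _.
have := card_nbrs_le (gball m u) reg; rewrite expnSr mulnS => H.
by apply: leq_add => //; apply: leq_trans H _; rewrite leq_mul2r IH orbT.
Qed.

Lemma e_betweenE S T : e_between S T = \sum_(u in S) #|nbr u :&: T|.
Proof.
rewrite /e_between -sum1_card.
rewrite (partition_big (fun p : G * G => p.1) (fun u => u \in S)) /=; last first.
  by move=> p; rewrite inE => /and3P[].
apply: eq_bigr => u uS; rewrite -sum1_card.
rewrite (reindex_onto (fun w => (u, w)) (fun p : G * G => p.2)) /=; last first.
  by move=> [x y] /= /andP[_ /eqP ->].
by apply: eq_bigl => w; rewrite !inE /= uS !eqxx !andbT /= andbC.
Qed.

(** * Covering a set by the hull of a sparse certificate *)

Section Covers.

Variable d : nat.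

(* In an expander with lambda <= d / 5 the constants 100 and 11 / 20 give
   121 |hull T| <= 25 |nbrs T|; the ratio 25 / 121 has to be below 1 / 4. *)
Definition wide T := d * #|T| <= 100 * #|nbrs T|.

Definition spreading A : bool :=
  [exists T : {set G}, [&& T \subset A, wide T & 11 * #|G| <= 20 * #|nbrs T|]].

Lemma spreadingS A B : A \subset B -> spreading A -> spreading B.
Proof.
move=> AB /existsP[T /and3P[TA wT bT]]; apply/existsP; exists T.
by rewrite wT bT (subset_trans TA AB).
Qed.

Definition hull T : {set G} := [set u | 100 * #|nbr u :\: nbrs T| < d].

(** Fewer than d / 100 neighbours of u miss [nbrs T], so some neighbour of u is adjacent to T. *)
Lemma hull_meets u T : regular_graph G d -> u \in hull T ->
  exists2 t, t \in T & t \in gball 2 u.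
Proof.
move=> reg; rewrite inE => uT.
have [x xN xF] : exists2 x, x \in nbr u & x \in nbrs T.
  apply/exists_inP; apply: contraT => /exists_inPn H.
  have : nbr u :\: nbrs T = nbr u.
    by apply/setP => x; rewrite inE; case xu: (x \in nbr u); rewrite ?andbF // H.
  by move=> E; move: uT; rewrite E [#|nbr u|]reg; lia.
have /nbrsP[t tT tx] := xF; exists t => //.
apply: (@gball_step 1 u x); last by rewrite adj_sym.
by apply: (@gball_step 0 u u); rewrite ?inE // -in_nbr.
Qed.

(** T is a wide subset of A of maximal size. When v is in A, only sets containing v compete,
    starting from [[set v]]; this later anchors certificates at v. *)
Lemma cover_exists A v : 0 < d -> regular_graph G d ->
  exists T, [/\ T \subset A, wide T, A \subset hull T & (v \in A -> v \in T)].
Proof.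
move=> d0 reg.
pose P T := [&& T \subset A, wide T & ((v \in A) ==> (v \in T))].
have [T0 PT0] : exists T0, P T0.
  case vA: (v \in A).
    by exists [set v]; rewrite /P /wide sub1set vA nbrs1 [#|nbr v|]reg cards1 !inE eqxx /=; lia.
  by exists set0; rewrite /P /wide sub0set vA cards0 muln0.
(* A vertex of A outside the hull of a maximal T could be added to T. *)
have := @arg_maxnP _ T0 P (fun T => #|T|) PT0.
case=> T /and3P[TA wT vT] maxT; exists T; split => //; last by apply/implyP.
apply/subsetP => u uA; rewrite inE ltnNge; apply/negP => Hu.
have uT : u \notin T.
  apply/negP => /sub_nbrs; rewrite -setD_eq0 => /eqP E; move: Hu.
  by rewrite E cards0 muln0 leqNgt d0.
have /maxT : P (u |: T).
  apply/and3P; split; last by apply/implyP => vA; rewrite inE (implyP vT vA) orbT.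
    by rewrite subUset sub1set uA.
  rewrite /wide cardsU1 uT nbrsU nbrs1 mulnDr muln1.
  rewrite -(cardsID (nbrs T) (nbr u :|: nbrs T)).
  rewrite setDUl setDv setU0 setIC setIUr setIid setUC.
  rewrite (setUidPl (subsetIl _ _)) mulnDr addnC; move: wT; rewrite /wide; lia.
by rewrite cardsU1 uT /= ltnn.
Qed.

End Covers.

End Neighbourhoods.

Arguments gball : simpl never.

(** * Consequences of expander mixing *)

Section Mixing.

Local Open Scope ring_scope.

Variables (R : realType) (G : sgraph) (n d : nat) (lambda : R).
Hypothesis expG : expander G n d lambda.
Hypothesis d_gt0 : (0 < d)%N.
Hypothesis lambda_le : lambda <= d%:R / 5.

(** F has density at most 11 / 20, so the mixing inequality charges the excess (theta - 11 / 20) d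
    |S| of edges to lambda sqrt(|S||F|); squaring and cancelling |S| gives the bound. The second
    part recovers the sign of [lambda], which allows comparing squares. *)
Lemma mixing_bound (theta : R) (S F : {set G}) :
  11 / 20 <= theta -> (20 * #|F| <= 11 * n)%N ->
  (forall u, u \in S -> theta * d%:R <= #|nbr u :&: F|%:R) ->
  ((theta - 11 / 20) * d%:R) ^+ 2 * #|S|%:R <= lambda ^+ 2 * #|F|%:R
  /\ (11 / 20 < theta -> (0 < #|S|)%N -> 0 < lambda).
Proof.
move=> th Fn HS; have [cardG reg mix] := expG.
have /= := mix S F; rewrite e_betweenE => mSF.
set s : R := #|S|%:R in mSF *; set f : R := #|F|%:R in mSF *.
have s0 : 0 <= s by rewrite ler0n.
have f0 : 0 <= f by rewrite ler0n.
have d0 : 0 < d%:R :> R by rewrite ltr0n.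
have lowe : theta * d%:R * s <= (\sum_(u in S) #|nbr u :&: F|)%:R.
  rewrite natr_sum mulrC /s mulr_natl -sumr_const; exact: ler_sum.
have fn : d%:R / n%:R * s * f <= 11 / 20 * d%:R * s.
  case: (posnP n) => [n0|n0].
    by rewrite n0 invr0 mulr0 !mul0r mulr_ge0 // mulr_ge0 // ltW.
  have nR : 0 < n%:R :> R by rewrite ltr0n.
  have : 20 * f <= 11 * n%:R by rewrite /f -!natrM ler_nat.
  move=> H; have -> : d%:R / n%:R * s * f = d%:R * s * (f / n%:R) by ring.
  have -> : 11 / 20 * d%:R * s = d%:R * s * (11 / 20) by ring.
  by rewrite ler_wpM2l ?mulr_ge0 ?(ltW d0) // ler_pdivrMr //; lra.
have key : (theta - 11 / 20) * d%:R * s <= lambda * Num.sqrt (s * f).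
  have := ler_norm ((\sum_(u in S) #|nbr u :&: F|)%:R - d%:R / n%:R * s * f).
  move: mSF lowe fn; rewrite !mulrBl; lra.
have sf : 0 <= s * f by exact: mulr_ge0.
split; last first.
  move=> th' S0; have sp : 0 < s by rewrite /s ltr0n.
  have lhs : 0 < (theta - 11 / 20) * d%:R * s by rewrite !mulr_gt0 // subr_gt0.
  have := lt_le_trans lhs key; apply: contraTT; rewrite -!leNgt => l0.
  by rewrite mulr_le0_ge0 // sqrtr_ge0.
have [s_eq0|s_neq0] := eqVneq s 0; first by rewrite s_eq0 mulr0 mulr_ge0 ?sqr_ge0.
have sp : 0 < s by rewrite lt_def s_neq0.
have lhs0 : 0 <= (theta - 11 / 20) * d%:R * s.
  by rewrite !mulr_ge0 ?subr_ge0 // ltW.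
have := ler_pM lhs0 lhs0 key key.
have -> : lambda * Num.sqrt (s * f) * (lambda * Num.sqrt (s * f)) =
          lambda ^+ 2 * f * s.
  by rewrite -expr2 exprMn sqr_sqrtr //; ring.
rewrite -expr2 exprMn [s ^+ 2]expr2 mulrA; by rewrite ler_pM2r.
Qed.

(** Here theta = 99 / 100, theta - 11 / 20 = 11 / 25, and lambda^2 <= d^2 / 25. *)
Lemma hull_card (T : {set G}) : (20 * #|nbrs T| < 11 * n)%N ->
  (121 * #|hull d T| <= 25 * #|nbrs T|)%N.
Proof.
move=> Tn; have [_ reg _] := expG.
have d0 : 0 < d%:R :> R by rewrite ltr0n.
have [||u|] := @mixing_bound (99 / 100) (hull d T) (nbrs T); first by lra.
- exact: ltnW.
- rewrite inE => uT.
  have := cardsID (nbrs T) (nbr u); rewrite [RHS]reg => E.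
  have : (99 * d <= 100 * #|nbr u :&: nbrs T|)%N by lia.
  by rewrite -(ler_nat R) !natrM; lra.
move=> H pos; have [S0|S0] := posnP #|hull d T|; first by rewrite S0 muln0.
have l0 : 0 < lambda by apply: pos S0; lra.
have l2 : lambda ^+ 2 <= (d%:R / 5) ^+ 2 by rewrite ler_sqr ?nnegrE ?divr_ge0 // ltW.
have f0 : 0 <= #|nbrs T|%:R :> R by rewrite ler0n.
have {}H := le_trans H (ler_wpM2r f0 l2).
rewrite -(ler_nat R) !natrM.
have d2 : 0 < d%:R ^+ 2 :> R by rewrite exprn_gt0.
rewrite -(ler_pM2l d2); move: H; rewrite !exprMn; lra.
Qed.

(** With theta = 1 the growth factor is (9 / 20)^2 (d / lambda)^2; one factor d / lambda >= 5
    absorbs the constant 81 / 400. *)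
Lemma nbrs_growth (A : {set G}) : (20 * #|nbrs A| <= 11 * n)%N ->
  d%:R / lambda * #|A|%:R <= #|nbrs A|%:R.
Proof.
move=> An; have [_ reg _] := expG.
have d0 : 0 < d%:R :> R by rewrite ltr0n.
have [||u uA|] := @mixing_bound 1 A (nbrs A); [by lra|exact: An| |].
  by rewrite mul1r (setIidPl (sub_nbrs uA)) [#|nbr u|]reg.
move=> H pos; have [A0|A0] := posnP #|A|; first by rewrite A0 mulr0 ler0n.
have l0 : 0 < lambda by apply: pos A0; lra.
have A0' : 0 <= #|A|%:R :> R by rewrite ler0n.
have l2 : 0 < lambda ^+ 2 by rewrite exprn_gt0.
rewrite -(ler_pM2l l2); apply: le_trans H.
have -> : lambda ^+ 2 * (d%:R / lambda * #|A|%:R) = lambda * d%:R * #|A|%:R.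
  by field; rewrite gt_eqF.
apply: ler_wpM2r => //.
have : lambda * d%:R <= d%:R / 5 * d%:R by rewrite ler_wpM2r // ltW.
have : 0 <= d%:R * d%:R :> R by rewrite mulr_ge0 // ltW.
by rewrite expr2; lra.
Qed.

End Mixing.

(** * Counting connected sets *)

Section LinkedSets.

Variable T : finType.
Variable e : rel T.

Definition linked (v : T) (X : {set T}) : bool :=
  (v \in X) && [forall x in X, connect (fun a b => e a b && (b \in X)) v x].

(** The detour y, z, y is inserted at an occurrence of y: two more steps, and z becomes visited. *)
Lemma path_insert x y z p : e y z -> e z y -> path e x p -> y \in x :: p ->
  exists q, [/\ path e x q, size q = (size p).+2 & x :: q =i z :: x :: p].
Proof.
move=> yz zy pth yp; case/splitPl: yp pth => p1 p2 lp1; rewrite cat_path => /andP[P1 P2].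
exists (p1 ++ [:: z, y & p2]); split.
- by rewrite cat_path P1 /= lp1 yz zy; rewrite lp1 in P2.
- by rewrite !size_cat /= !addnS.
- move=> a; rewrite !inE !mem_cat !inE.
  have : y \in x :: p1 by rewrite -lp1 mem_last.
  rewrite inE; have [->|] := eqVneq a y; last by do !case: (_ == _); do !case: (_ \in _).
  by case/orP => ->; rewrite !orbT.
Qed.

(** One detour per new vertex, as in a walk around a spanning tree, gives length 2(|X| - 1). *)
Lemma linked_walk v X : symmetric e -> linked v X ->
  exists p, [/\ path e v p, size p = (#|X|.-1).*2 & [set x in v :: p] = X].
Proof.
move=> sym /andP[vX /forall_inP con].
have X0 : 0 < #|X| by apply/card_gt0P; exists v.
suff: forall m, m < #|X| -> exists p, [/\ path e v p, size p = m.*2,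
    [set x in v :: p] \subset X & #|[set x in v :: p]| = m.+1].
  move=> /(_ #|X|.-1)[|p [pth sz sub cd]]; first by rewrite ltn_predL.
  exists p; split=> //; apply/eqP.
  by rewrite eqEcard sub cd prednK ?leqnn.
elim=> [_|m IH mX].
  exists [::]; split=> //; first by apply/subsetP => x; rewrite !inE => /eqP ->.
  by rewrite (_ : [set x in [:: v]] = [set v]) ?cards1 //; apply/setP => x; rewrite !inE.
have [p [pth sz sub cd]] := IH (ltnW mX).
set Z := [set x in v :: p] in sub cd.
(* A path inside X from v to an unvisited vertex must leave the visited set along some edge. *)
have [y yZ [z [zX zZ yz]]] : exists2 y, y \in Z & exists z, [/\ z \in X, z \notin Z & e y z].
  have /subsetPn[x xX xZ] : ~~ (X \subset Z).
    by apply/negP => /subset_leq_card; rewrite cd leqNgt mX.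
  have /connectP[s ps xs] := con x xX.
  have vZ : v \in Z by rewrite !inE eqxx.
  move: (Z) xZ vZ; elim: s (v) ps xs => [|w s IHs] a /=.
    by move=> _ -> Z' /negPf ->.
  move=> /andP[/andP[aw wX] ps] xs Z' xZ' aZ'.
  have [wZ|wZ] := boolP (w \in Z'); first exact: IHs ps xs Z' xZ' wZ.
  by exists a => //; exists w.
have zy : e z y by rewrite sym.
have [q [pq sq eq]] := path_insert yz zy pth (etrans (esym (in_set _ _)) yZ).
have eZ : [set x in v :: q] = z |: Z.
  by apply/setP => x; have := eq x; rewrite !inE.
exists q; rewrite sq sz eZ cardsU1 zZ cd; split=> //.
by rewrite subUset sub1set zX.
Qed.

(** A set is recovered from its covering walk, so walks with 2m steps from v are counted instead. *)
Lemma card_linked v m D : symmetric e -> (forall a, #|[set b | e a b]| <= D) ->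
  #|[set X | linked v X && (#|X| == m.+1)]| <= D ^ m.*2.
Proof.
move=> sym degD.
have cpath k : forall a, #|[set p : k.-tuple T | path e a p]| <= D ^ k.
  elim: k => [|k IH] a.
    by apply: leq_trans (max_card _) _; rewrite card_tuple expn0.
  rewrite expnS; apply: (@leq_trans (\sum_(b in [set b | e a b]) D ^ k)); last first.
    by rewrite sum_nat_const leq_mul2r degD orbT.
  rewrite -sum1_card (partition_big (fun p : k.+1.-tuple T => thead p)
      (fun b => b \in [set b | e a b])) /=; last first.
    by move=> p; case/tupleP: p => b p; rewrite !inE theadE => /andP[].
  apply: leq_sum => b _; apply: leq_trans (IH b); rewrite -sum1_card.
  rewrite (reindex_onto (fun p : k.-tuple T => [tuple of b :: p])
      (fun p : k.+1.-tuple T => [tuple of behead p])) /=; last first.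
    move=> p; case/tupleP: p => c p; rewrite theadE => /andP[_ /eqP ->].
    by apply: val_inj.
  apply: leq_trans (_ : \sum_(p | p \in [set p : k.-tuple T | path e b p]) 1 <= _) => //.
  by apply: sub_le_big => //= [x y|p]; rewrite ?leq_addr // !inE => /andP[/andP[/andP[]]].
apply: leq_trans (cpath m.*2 v).
apply: leq_trans (leq_imset_card (fun p : m.*2.-tuple T => [set x in v :: p]) _).
apply: subset_leq_card; apply/subsetP => X; rewrite inE => /andP[lX /eqP cX].
have [p [pth sz defX]] := linked_walk sym lX.
have szm : size p == m.*2 by rewrite sz cX.
by apply/imsetP; exists (Tuple szm) => //; rewrite inE.
Qed.

End LinkedSets.

(** * Windows *)

Lemma sum_exp2_max (m : nat) (P : pred 'I_m) :
  \sum_(i < m | P i) 2 ^ i <= 2 * \max_(i < m | P i) 2 ^ i.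
Proof.
have [/existsP[i1 Pi1]|/existsPn nP] := boolP [exists i, P i]; last first.
  by rewrite big_pred0 // => i; apply/negbTE.
have [i0 Pi0 mx] : {i0 | P i0 & \max_(i < m | P i) 2 ^ i = 2 ^ i0}.
  by apply: eq_bigmax_cond; apply/card_gt0P; exists i1.
have geo k : \sum_(i < k) 2 ^ i < 2 ^ k.
  elim: k => [|k IH]; first by rewrite big_ord0.
  by rewrite big_ord_recr /= expnS mul2n -addnn -addSn leq_add2r.
rewrite mx -expnS; apply: leq_trans (ltnW (geo i0.+1)).
rewrite (big_ord_widen m (fun i => 2 ^ i) (ltn_ord i0)).
apply: sub_le_big => //= [x y|i Pi]; first exact: leq_addr.
by rewrite ltnS -(leq_exp2l _ _ (leqnn 2)) -mx; apply: leq_bigmax_cond.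
Qed.

(* An integer-valued function is represented by its translate by b, so that the
   window [0, M] becomes [b, b + M]; values stay in [0, 2 b + M] when b is at
   least M times the number of vertices. *)
Section Windows.

Variables (G : sgraph) (d b M : nat).

Notation n := #|G|.
Notation phi := {ffun G -> 'I_(2 * b + M).+1}.
Notation family := {ffun 'I_b * bool -> {set G}}.
Implicit Types (g : phi) (T : family) (u w : G) (s : bool).

Definition lip g : bool :=
  [forall u, forall w, adj u w ==> (g u <= g w + M)].

Lemma lipP g : reflect (forall u w, adj u w -> g u <= g w + M) (lip g).
Proof.
apply: (iffP forallP) => [H u w uw|H u]; last by apply/forall_inP => w /H.
by have /forall_inP := H u; apply.
Qed.

(* Distance from [b, b + W] (truncated subtraction), counted only below the
   window for s = false and only above it for s = true. *)
Definition dep (W : nat) g s u : nat := if s then g u - (b + W) else b - g u.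

Definition lev (W : nat) g s (r : nat) : {set G} := [set u | r <= dep W g s u].

Definition shell T s (i : 'I_b) := nbrs (T (i, s)).
Definition hulls T s (i : 'I_b) := hull d (T (i, s)).

Definition rho T s u := \max_(i < b | u \in hulls T s i) 2 ^ i.
Definition tau T s u := \max_(i < b | u \in shell T s i) 2 ^ i.
Definition gain T := \sum_s \sum_(i < b) 2 ^ i * #|shell T s i|.

Definition sparse T := [forall k, wide d (T k) && (20 * #|nbrs (T k)| < 11 * n)].

Lemma dep_le W g s u : M <= W -> dep W g s u <= b.
Proof. by rewrite /dep; have := ltn_ord (g u); case: s; lia. Qed.

(* A maximum of distinct powers of 2 is at most their sum and at least half of it. *)
Lemma gain_rho_tau T :
  (forall X : {set G}, 20 * #|nbrs X| < 11 * n -> 121 * #|hull d X| <= 25 * #|nbrs X|) ->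
  sparse T ->
  12 * \sum_s \sum_u 2 * rho T s u + gain T <= 12 * \sum_s \sum_u tau T s u.
Proof.
move=> hullb /forallP sp.
have Hrho s : \sum_u rho T s u <= \sum_(i < b) 2 ^ i * #|hulls T s i|.
  apply: (@leq_trans (\sum_u \sum_(i < b | u \in hulls T s i) 2 ^ i)).
    apply: leq_sum => u _; rewrite /rho; apply/bigmax_leqP => i ui.
    by rewrite (bigD1 i) //= leq_addr.
  rewrite (exchange_big_dep predT) //=; apply: leq_sum => i _.
  by rewrite sum_nat_const mulnC.
have Htau s : \sum_(i < b) 2 ^ i * #|shell T s i| <= 2 * \sum_u tau T s u.
  rewrite big_distrr /=.
  apply: (@leq_trans (\sum_u \sum_(i < b | u \in shell T s i) 2 ^ i)).
    rewrite (exchange_big_dep predT) //=; apply: leq_sum => i _.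
    by rewrite sum_nat_const mulnC.
  by apply: leq_sum => u _; apply: sum_exp2_max.
have HFS s : 121 * \sum_(i < b) 2 ^ i * #|hulls T s i|
      <= 25 * \sum_(i < b) 2 ^ i * #|shell T s i|.
  rewrite !big_distrr /=; apply: leq_sum => i _; rewrite mulnCA [X in _ <= X]mulnCA.
  by rewrite leq_mul2l hullb ?orbT //; case/andP: (sp (i, s)).
have E s : \sum_u 2 * rho T s u = 2 * \sum_u rho T s u by rewrite big_distrr.
rewrite /gain !big_bool !E.
move: (Hrho true) (Hrho false) (Htau true) (Htau false) (HFS true) (HFS false).
move: (\sum_u rho T true u) (\sum_u rho T false u) (\sum_u tau T true u).
move: (\sum_u tau T false u) (\sum_(i < b) 2 ^ i * #|hulls T true i|).
move: (\sum_(i < b) 2 ^ i * #|hulls T false i|) (\sum_(i < b) 2 ^ i * #|shell T true i|).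
move: (\sum_(i < b) 2 ^ i * #|shell T false i|).
by move=> /=; lia.
Qed.

(** If 2^i is the largest power of 2 not exceeding the depth, u lies in the hull of index i, and the
    depth is below 2^(i+1). *)
Lemma dep_rho W g T s u : M <= W ->
  (forall i : 'I_b, u \in lev W g s (2 ^ i) -> u \in hulls T s i) ->
  dep W g s u <= 2 * rho T s u.
Proof.
move=> M_le_W H; have [->//|pos] := posnP (dep W g s u).
have /andP[lo hi] := trunc_log_bounds (leqnn 2) pos.
(* The index is available because the depth is at most b < 2^b. *)
have ib : trunc_log 2 (dep W g s u) < b.
  rewrite -(ltn_exp2l _ _ (leqnn 2)); apply: leq_ltn_trans lo _.
  by apply: leq_ltn_trans (dep_le g s u M_le_W) _; apply: ltn_expl.
have : 2 ^ trunc_log 2 (dep W g s u) <= rho T s u.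
  apply: (@leq_bigmax_cond _ _ (fun i : 'I_b => 2 ^ i) (Ordinal ib)).
  by apply: H; rewrite inE.
by move: hi; rewrite expnS; lia.
Qed.

Section Fits.

Variables (W : nat) (g : phi) (T : family).
Hypothesis lip_g : lip g.
Hypothesis T_lev : forall s (i : 'I_b), T (i, s) \subset lev W g s (2 ^ i).

Lemma tau_attained s u : 0 < tau T s u ->
  exists2 t, adj t u & tau T s u <= dep W g s t.
Proof.
move=> pos; have [i ui ->] : exists2 i : 'I_b, u \in shell T s i & tau T s u = 2 ^ i.
  rewrite /tau in pos *; case: (pickP (fun i : 'I_b => u \in shell T s i)) => [i0 Pi0|nP].
    have [|i Pi ->] := @eq_bigmax_cond _ [pred i | u \in shell T s i] (fun i => 2 ^ i).
      by apply/card_gt0P; exists i0.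
    by exists i.
  by move: pos; rewrite big_pred0.
have /nbrsP[t tT tu] := ui; exists t => //.
by have := subsetP (T_lev s i) t tT; rewrite inE.
Qed.

(** A neighbour at depth at least tau below the window keeps g u at most b - tau + M. *)
Lemma tau_false u : 0 < tau T false u -> g u + tau T false u <= b + M.
Proof.
move=> pos; have [t tu H] := tau_attained pos.
have := lipP _ lip_g u t; rewrite adj_sym => /(_ tu).
by move: H pos; rewrite /dep; lia.
Qed.

Lemma tau_true u : 0 < tau T true u -> b + W + tau T true u <= g u + M.
Proof.
move=> pos; have [t tu H] := tau_attained pos.
have := lipP _ lip_g t u tu.
by move: H pos; rewrite /dep; lia.
Qed.

End Fits.

Lemma card_ord_window (m : nat) (A : {set 'I_m}) lo hi :
  (forall x, x \in A -> lo <= x < hi) -> #|A| <= hi - lo.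
Proof.
move=> H; rewrite -(size_iota lo (hi - lo)) cardE -(size_map val).
apply: uniq_leq_size; first by rewrite map_inj_uniq ?enum_uniq //; apply: val_inj.
move=> _ /mapP[x xA ->]; rewrite mem_enum in xA; rewrite mem_iota.
by have /andP[lox xhi] := H x xA; rewrite subnKC ?lox ?xhi ?(ltnW (leq_ltn_trans lox xhi)).
Qed.

End Windows.

(** * Product bounds and generating functions *)

Section Counting.

Local Open Scope ring_scope.
Variable R : realType.

(** Each nonzero factor is at most (M + 1)(1 + x_i / (M + 1)), and 1 + y <= exp y. The case c i = 0
    is kept apart because M + 1 + x_i may then be negative. *)
Lemma prod_window_le (I : finType) (M : nat) (c : I -> nat) (x : I -> R) :
  (forall i, c i = 0%N \/ (c i)%:R <= M.+1%:R + x i) ->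
  (\prod_i c i)%:R <= M.+1%:R ^+ #|I| * expR ((\sum_i x i) / M.+1%:R).
Proof.
move=> H; have M0 : 0 < M.+1%:R :> R by rewrite ltr0n.
have -> : M.+1%:R ^+ #|I| * expR ((\sum_i x i) / M.+1%:R) =
    \prod_i (M.+1%:R * expR (x i / M.+1%:R)).
  by rewrite big_split /= prodr_const -expR_sum mulr_suml.
rewrite natr_prod; apply: ler_prod => i _; rewrite ler0n /=.
case: (H i) => [->|le]; first by rewrite mulr_ge0 ?expR_ge0 ?ltW.
apply: le_trans le _; have := expR_ge1Dx (x i / M.+1%:R).
rewrite -(ler_pM2l M0); apply: le_trans.
by rewrite mulrDr mulr1 mulrCA divff ?gt_eqF // mulr1.
Qed.

Lemma ler_sum_sub (I : finType) (P Q : pred I) (F : I -> R) :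
  (forall i, 0 <= F i) -> (forall i, P i -> Q i) ->
  \sum_(i | P i) F i <= \sum_(i | Q i) F i.
Proof.
move=> F0 PQ; rewrite [leLHS]big_mkcond [leRHS]big_mkcond; apply: ler_sum => i _.
by case: ifP => [/PQ ->//|_]; case: ifP.
Qed.

(** Expanding the product of 1 + q over the elements of A amounts to choosing a subset of A. *)
Lemma sum_set_expr (T : finType) (A : {set T}) (q : R) :
  \sum_(X : {set T} | X \subset A) q ^+ #|X| = (1 + q) ^+ #|A|.
Proof.
have := bigA_distr (1 : R) +%R (fun i : T => if i \in A then q else 0) (fun=> 1).
rewrite (bigID (mem A)) /= [X in _ * X]big1 => [|i /negbTE ->]; last by rewrite add0r.
rewrite mulr1 (eq_bigr (fun=> 1 + q)) => [|i ->]; last by rewrite addrC.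
rewrite prodr_const => ->; rewrite [RHS](bigID (fun X : {set T} => X \subset A)) /=.
rewrite [X in _ = _ + X]big1 ?addr0 => [|X /subsetPn[x xX xA]]; last first.
  by rewrite (bigD1 x) //= xX (negbTE xA) mul0r.
apply: eq_bigr => X /subsetP XA; rewrite -big_mkcond /=.
by rewrite (eq_bigr (fun=> q)) ?prodr_const // => i /XA ->.
Qed.

Lemma sum_family_subset (T K : finType) (A : {set T}) (q : K -> R) :
  \sum_(F : {ffun K -> {set T}} | [forall k, F k \subset A])
     \prod_k q k ^+ #|F k| = \prod_k (1 + q k) ^+ #|A|.
Proof.
rewrite (eq_bigr (fun k => \sum_(X : {set T}) if X \subset A then q k ^+ #|X| else 0)).
  rewrite bigA_distr_bigA /= [RHS](bigID (fun F : {ffun K -> {set T}} => [forall k, F k \subset A])) /=.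
  rewrite [X in _ = _ + X]big1 ?addr0 => [|F /forallPn[k /negbTE Fk]]; last first.
    by rewrite (bigD1 k) //= Fk mul0r.
  by apply: eq_bigr => F /forallP FA; apply: eq_bigr => k _; rewrite FA.
by move=> k _; rewrite -sum_set_expr -big_mkcond.
Qed.

(** Multiplied by 1 - q the product telescopes, and 1 / (1 - q) <= 1 + 2q for q <= 1 / 2. *)
Lemma prod_dyadic (q : R) (m : nat) :
  0 <= q <= 1 / 2 -> \prod_(i < m) (1 + q ^+ (2 ^ i)) <= 1 + 2 * q.
Proof.
move=> /andP[q0 q1].
have tel : (1 - q) * \prod_(i < m) (1 + q ^+ (2 ^ i)) = 1 - q ^+ (2 ^ m).
  elim: m => [|m IH]; first by rewrite big_ord0 mulr1 expr1.
  by rewrite big_ord_recr /= mulrA IH expnSr exprM; ring.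
have h : 0 < 1 - q by lra.
rewrite -(ler_pM2l h) tel; have : 0 <= q ^+ (2 ^ m) by rewrite exprn_ge0.
by nra.
Qed.

End Counting.

(** * Certificates around a vertex *)

Section LocalFamilies.

Variables (G : sgraph) (d b M : nat).
Hypothesis reg : regular_graph G d.
Hypothesis d_gt0 : 0 < d.
Hypothesis hullb : forall X : {set G},
  20 * #|nbrs X| < 11 * #|G| -> 121 * #|hull d X| <= 25 * #|nbrs X|.

Notation n := #|G|.
Notation phi := {ffun G -> 'I_(2 * b + M).+1}.
Notation family := {ffun 'I_b * bool -> {set G}}.
Implicit Types (g : phi) (T : family) (u v w : G) (s : bool).

Definition balanced : {set phi} :=
  [set g : phi | [&& lip g, ~~ spreading d (lev M g false 1) & ~~ spreading d (lev M g true 1)]].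

Definition support T : {set G} := \bigcup_k T k.
Definition region T : {set G} := \bigcup_k (hull d (T k) :|: nbrs (T k)).

(** Linked vertices of the component are at distance at most 3, and each is within 2 of the support:
    7 = 2 + 3 + 2. *)
Definition near7 : rel G := [rel x y | y \in gball 7 x].

(* T certifies the component of v, for links of length at most 3, in the set
   where g leaves [b, b + M].  By adm_boundary, g stays in the window just
   outside the region, so that it can be resampled inside it. *)
Record admissible g v T : Prop := Admissible {
  adm_lev : forall s (i : 'I_b), T (i, s) \subset lev M g s (2 ^ i);
  adm_sparse : sparse d T;
  adm_hull : forall u, u \in region T -> forall s (i : 'I_b),
    u \in lev M g s (2 ^ i) -> u \in hulls d T s i;
  adm_boundary : forall u w, u \in region T -> w \notin region T -> adj u w ->
    forall s, dep M g s w = 0;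
  adm_linked : linked near7 v (support T) }.

Lemma dep_adj W g s u w : lip g -> adj u w -> dep W g s u <= dep W g s w + M.
Proof.
move=> /lipP lg uw; have h1 := lg u w uw; have h2 := lg w u.
rewrite adj_sym in h2; move: (h2 uw) h1; rewrite /dep; case: s; lia.
Qed.

(** Otherwise [T (i, s)] itself would witness that the level set of depth 1 spreads. *)
Lemma sparse_of_small W g s T (i : 'I_b) :
  ~~ spreading d (lev W g s 1) -> wide d (T (i, s)) -> T (i, s) \subset lev W g s (2 ^ i) ->
  20 * #|nbrs (T (i, s))| < 11 * n.
Proof.
move=> sm wT Tl; rewrite ltnNge; apply/negP => H; move/negP: sm; apply.
apply/existsP; exists (T (i, s)); rewrite wT H !andbT.
apply: subset_trans Tl _; apply/subsetP => x; rewrite !inE; apply: leq_trans.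
by rewrite expn_gt0.
Qed.

Lemma gain_ge_shell T s (i : 'I_b) : 2 ^ i * #|shell T s i| <= gain T.
Proof.
by rewrite /gain (bigD1 s) //= (bigD1 i) //= -addnA leq_addr.
Qed.

Lemma hull_nbrs_sub_region T k : hull d (T k) :|: nbrs (T k) \subset region T.
Proof. exact: (bigcup_sup k). Qed.

(** Every level of the component Y is covered by [cover_exists]. Where v belongs to the level it
    belongs to T, and [nbr v] alone contributes 2^i d to the gain. Depth drops by at most M per
    edge, so depth above jM keeps the j-step neighbourhood in Y, hence in the hull of index 0, whose
    size is controlled by [hullb]. *)
Lemma admissible_exists g v s0 : g \in balanced -> 0 < dep M g s0 v ->
  exists T, [/\ admissible g v T,
    forall i : 'I_b, 2 ^ i <= dep M g s0 v -> 2 ^ i * d <= gain T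
  & forall j, j * M < dep M g s0 v ->
      #|iter j (@nbrs G) [set v]| <= gain T /\
      20 * #|iter j (@nbrs G) [set v]| <= 11 * n].
Proof.
rewrite inE => /and3P[lg small_f small_t] dv.
have small s : ~~ spreading d (lev M g s 1) by case: s.
pose defect u := (0 < dep M g false u) || (0 < dep M g true u).
have defectE s u : 0 < dep M g s u -> defect u.
  by rewrite /defect; case: s => ->; rewrite ?orbT.
pose lk := [rel x y | (y \in gball 3 x) && defect y].
pose Y := [set y | connect lk v y].
have vY : v \in Y by rewrite inE connect0.
have Ydef y : y \in Y -> defect y.
  rewrite inE => /connectP[p]; elim/last_ind: p => [_ ->|p x _]; first exact: defectE dv.
  by rewrite rcons_path last_rcons => /andP[_ /andP[_ dx]] ->.
have Yext y x : y \in Y -> x \in gball 3 y -> defect x -> x \in Y.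
  rewrite [y \in Y]inE [x \in Y]inE => vy xy dx; apply: connect_trans vy _; apply: connect1.
  by apply/andP.
have b0 : 0 < b by apply: leq_trans dv (dep_le _ _ _ (leqnn M)).
pose o : 'I_b := Ordinal b0.
pose A (k : 'I_b * bool) := Y :&: lev M g k.2 (2 ^ k.1).
have [Tf HT] := choice (fun k => cover_exists (A k) v d_gt0 reg).
pose T : family := [ffun k => Tf k].
have TA k : T k \subset A k by rewrite ffunE; have [] := HT k.
have wT k : wide d (T k) by rewrite ffunE; have [] := HT k.
have AT k : A k \subset hull d (T k) by rewrite ffunE; have [] := HT k.
have vT k : v \in A k -> v \in T k by rewrite ffunE; have [] := HT k.
have Tlev s (i : 'I_b) : T (i, s) \subset lev M g s (2 ^ i).
  exact: subset_trans (TA _) (subsetIr _ _).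
have spT : sparse d T.
  apply/forallP => -[i s]; rewrite wT /=; exact: sparse_of_small (small s) (wT _) (Tlev s i).
have suppY x : x \in support T -> x \in Y.
  by move=> /bigcupP[k _ /(subsetP (TA k))]; rewrite inE => /andP[].
have hullY s y : y \in Y -> 0 < dep M g s y -> y \in hull d (T (o, s)).
  by move=> yY dy; apply: (subsetP (AT _)); rewrite inE yY inE /= expn0.
have Yregion y : y \in Y -> y \in region T.
  move=> yY; have /orP[dy|dy] := Ydef y yY.
    by apply: (subsetP (hull_nbrs_sub_region T (o, false))); rewrite inE hullY.
  by apply: (subsetP (hull_nbrs_sub_region T (o, true))); rewrite inE hullY.
have meetH k u : u \in hull d (T k) -> exists2 t, t \in support T & t \in gball 2 u.
  by move=> /(hull_meets reg)[t tk tu]; exists t => //; apply/bigcupP; exists k.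
have meetY y : y \in Y -> exists2 t, t \in support T & t \in gball 2 y.
  move=> yY; have /orP[dy|dy] := Ydef y yY; exact: meetH (hullY _ _ yY dy).
have regB u : u \in region T -> exists2 t, t \in support T & u \in gball 2 t.
  move=> /bigcupP[k _]; rewrite inE => /orP[/meetH[t tT tu]|/nbrsP[t tT tu]].
    by exists t => //; apply: gball_sym.
  exists t; first by apply/bigcupP; exists k.
  by apply: (subsetP (gballS 1 t)); apply: (gball_step _ tu); apply: gball_self.
exists T; split.
- split=> //.
  + move=> u uR s i ul; apply: (subsetP (AT (i, s))); rewrite inE ul andbT.
    have [t tT ut] := regB u uR; apply: (Yext t) => //; first exact: suppY.
      exact: (subsetP (gballS 2 t)).
    by apply: (defectE s); move: ul; rewrite inE; apply: leq_trans; rewrite expn_gt0.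
  (* The region is within distance 2 of Y, so a neighbour w lying off the window would be at
     distance at most 3 from Y, hence in Y and in the region. *)
  + move=> u w uR wR uw s; apply/eqP; rewrite -leqn0 leqNgt; apply/negP => dw.
    move/negP: wR; apply; apply: Yregion; have [t tT ut] := regB u uR.
    by apply: (Yext t); [exact: suppY|exact: gball_step uw|exact: defectE dw].
  + apply/andP; split.
      apply/bigcupP; exists (o, s0) => //; apply: vT.
      by rewrite inE vY inE /= expn0.
    (* A chain in Y is shadowed by a chain of support vertices, each within distance 2 of the
       original vertex. *)
    have key y : y \in Y -> forall t, t \in support T -> t \in gball 2 y ->
        connect (fun x z => near7 x z && (z \in support T)) v t.
      rewrite inE => /connectP[p]; elim/last_ind: p y => [|p x IH] y.
        move=> _ -> t tT tv; apply: connect1; rewrite tT andbT /=.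
        exact: (subsetP (@gball_leq _ 2 7 v isT)).
      rewrite rcons_path last_rcons => /andP[pp /andP[lx dx]] -> t tT tx.
      have yY : last v p \in Y by rewrite inE; apply/connectP; exists p.
      have [t' t'T t'y] := meetY _ yY.
      apply: connect_trans (IH _ pp erefl t' t'T t'y) _; apply: connect1.
      rewrite tT andbT /=; apply: (@gball_trans _ 5 2 _ x) => //.
      by apply: (@gball_trans _ 2 3 _ (last v p)) => //; apply: gball_sym.
    by apply/forall_inP => x xT; apply: (key x) => //; [exact: suppY|exact: gball_self].
- move=> i di; apply: leq_trans (gain_ge_shell T s0 i); rewrite leq_mul2l.
  rewrite -(reg v) subset_leq_card ?orbT // (sub_nbrs (A := T (i, s0))) //.
  by apply: vT; rewrite inE vY inE.
- move=> j dj.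
  have Zsub : iter j (@nbrs G) [set v] \subset hull d (T (o, s0)).
    (* After i steps from v the depth still exceeds (j - i)M, so the vertex stays in Y. *)
    suff H : forall i z, i <= j -> z \in iter i (@nbrs G) [set v] ->
        (j * M < dep M g s0 z + i * M) && (z \in Y).
      apply/subsetP => z /H - /(_ (leqnn j)) /andP[dz zY].
      by apply: hullY => //; lia.
    elim=> [|i IH] z ij /=; first by rewrite inE => /eqP ->; rewrite vY; lia.
    move=> /nbrsP[u uZ uz]; have /andP[du uY] := IH u (ltnW ij) uZ.
    have := dep_adj M s0 lg uz => duz.
    have dz : j * M < dep M g s0 z + i.+1 * M by lia.
    rewrite dz /=; apply: (Yext u) => //.
      by apply: (subsetP (@gball_leq _ 1 3 u isT)); apply: (gball_step _ uz); apply: gball_self.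
    apply: (defectE s0); have : i.+1 * M <= j * M by rewrite leq_mul2r ij orbT.
    lia.
  have cz := subset_leq_card Zsub.
  have /andP[_ cs] := forallP spT (o, s0).
  have := hullb cs; have := gain_ge_shell T s0 o; rewrite expn0 mul1n /shell.
  by move=> h1 h2; split; lia.
Qed.

End LocalFamilies.

Lemma card_windows (I : finType) (m : nat) (W : I -> {set 'I_m}) :
  #|[set h : {ffun I -> 'I_m} | [forall i, h i \in W i]]| = \prod_i #|W i|.
Proof.
transitivity #|(family (fun i => mem (W i)) : simpl_pred {dffun forall _ : I, 'I_m})|.
  by apply: eq_card => h; rewrite inE; apply/forallP/familyP.
by rewrite card_family foldrE big_image.
Qed.

(** * Resampling *)

Section LocalCounting.

Local Open Scope ring_scope.

Variables (R : realType) (G : sgraph) (d b M : nat).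
Hypothesis hullb : forall X : {set G},
  (20 * #|nbrs X| < 11 * #|G|)%N -> (121 * #|hull d X| <= 25 * #|nbrs X|)%N.

Notation n := #|G|.
Notation phi := {ffun G -> 'I_(2 * b + M).+1}.
Notation family := {ffun 'I_b * bool -> {set G}}.
Implicit Types (g h : phi) (T : family) (u v w : G) (s : bool).

Definition flat : {set phi} := [set h : phi | [forall u, (b <= h u <= b + M)%N]].

Lemma card_flat : #|flat| = (M.+1 ^ n)%N.
Proof.
pose W (u : G) : {set 'I_(2 * b + M).+1} := [set x : 'I_(2 * b + M).+1 | (b <= x <= b + M)%N].
have -> : flat = [set h : phi | [forall u, h u \in W u]].
  by apply/setP => h; rewrite !inE; apply: eq_forallb => u; rewrite inE.
rewrite card_windows; have Wc : #|[set x : 'I_(2 * b + M).+1 | (b <= x <= b + M)%N]| = M.+1.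
  apply/eqP; rewrite eqn_leq; apply/andP; split.
    have -> : M.+1 = ((b + M).+1 - b)%N by lia.
    by apply: card_ord_window => x; rewrite inE ltnS.
  have inj : injective (fun i : 'I_M.+1 => inord (b + i) : 'I_(2 * b + M).+1).
    move=> i j /(congr1 val) /=; have := ltn_ord i; have := ltn_ord j => hj hi.
    by rewrite !inordK; [move=> E; apply: val_inj => /=; lia|lia|lia].
  rewrite -[X in (X <= _)%N]card_ord -(card_imset _ inj); apply: subset_leq_card.
  apply/subsetP => _ /imsetP[i _ ->]; rewrite inE.
  by have := ltn_ord i => hi; rewrite inordK; lia.
by rewrite (eq_bigr (fun=> M.+1)) ?prod_nat_const // big_const iter_muln_1.
Qed.

(** The values at u compatible with the certificates, stated by additions to avoid truncated
    subtraction. *)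
Definition window T u : {set 'I_(2 * b + M).+1} :=
  [set x : 'I_(2 * b + M).+1 | (x + tau T false u <= b + M + 2 * rho d T true u)%N &&
           (b + tau T true u <= x + 2 * rho d T false u)%N].

Definition mix (Q : {set G}) g h : phi := [ffun u => if u \in Q then h u else g u].

Lemma tau_out T s u : u \notin region d T -> tau T s u = 0%N.
Proof.
move=> uQ; rewrite /tau big_pred0 // => i; apply/negbTE.
apply: contra uQ => ui; apply: (subsetP (hull_nbrs_sub_region d T (i, s))).
by rewrite inE ui orbT.
Qed.

(** Only edges crossing the boundary of the region need care: there g is in the window by
    [adm_boundary], so both ends take values in an interval of length M. Depths can only decrease,
    so no level set starts to spread. *)
Lemma mix_balanced g h v T : g \in balanced G d b M -> h \in flat ->
  admissible d g v T -> mix (region d T) g h \in balanced G d b M.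
Proof.
set Q := region d T; rewrite inE => /and3P[lg smf smt]; rewrite inE => /forallP fl ad.
have out u w : u \in Q -> w \notin Q -> adj u w -> (b <= g w <= b + M)%N.
  move=> uQ wQ uw; have := adm_boundary ad uQ wQ uw.
  by move=> H; have := H true; have := H false; rewrite /dep; lia.
have dep_mix s u : (dep M (mix Q g h) s u <= dep M g s u)%N.
  rewrite /dep ffunE; have [uQ|_] := boolP (u \in Q); last exact: leqnn.
  by have /andP[lo hi] := fl u; case: (s); lia.
have sub s : lev M (mix Q g h) s 1 \subset lev M g s 1.
  by apply/subsetP => u; rewrite !inE => /leq_trans; apply.
rewrite inE; apply/and3P; split; last 2 first.
- by apply: contra smf; apply: spreadingS.
- by apply: contra smt; apply: spreadingS.
apply/lipP => u w uw; rewrite !ffunE.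
have := fl u; have := fl w => hw hu.
case: ifP => uQ; case: ifP => wQ.
- by lia.
- by have := out u w uQ (negbT wQ) uw; lia.
- by rewrite adj_sym in uw; have := out w u wQ (negbT uQ) uw; lia.
- exact: (lipP _ lg).
Qed.

(** On the region the value is that of g, bounded by [rho] and by neighbours realising [tau];
    elsewhere it is that of the flat h and [tau] vanishes. *)
Lemma mix_window g h v T u : g \in balanced G d b M -> h \in flat ->
  admissible d g v T -> mix (region d T) h g u \in window T u.
Proof.
rewrite inE => /and3P[lg _ _]; rewrite inE => /forallP fl ad.
have lev := adm_lev ad; rewrite inE ffunE; case: ifP => uQ; last first.
  by have := fl u; rewrite !tau_out ?uQ //; lia.
have hrho s := dep_rho (leqnn M) (adm_hull ad uQ (s := s)).
have := hrho true; have := hrho false; rewrite /dep => rf rt.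
have tf : (0 < tau T false u -> g u + tau T false u <= b + M)%N.
  exact: (tau_false lg lev).
have tt : (0 < tau T true u -> b + M + tau T true u <= g u + M)%N.
  exact: (tau_true lg lev).
by move: tf tt; do 2 case: posnP => [->|_]; lia.
Qed.

(* Exchanging the values of g and of a flat h on the region is injective on
   pairs (g, h). *)
Lemma admissible_count_nat v T :
  (#|[set g in balanced G d b M | `[< admissible d g v T >]]| * M.+1 ^ n
    <= #|balanced G d b M| * \prod_u #|window T u|)%N.
Proof.
set E := [set g in _ | _].
rewrite -card_flat -card_windows -!cardsX.
pose f (p : phi * phi) := (mix (region d T) p.1 p.2, mix (region d T) p.2 p.1).
have inj : injective f.
  move=> [g h] [g' h'] E0.
  have /ffunP E1 := congr1 fst E0; have /ffunP E2 := congr1 snd E0.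
  by congr pair; apply/ffunP => u; have := E1 u; have := E2 u; rewrite !ffunE; case: ifP.
rewrite -(card_imset _ inj); apply: subset_leq_card.
apply/subsetP => _ /imsetP[[g h] /setXP[/= gE hf] ->].
move: gE; rewrite inE => /andP[gb /asboolP ad].
apply/setXP; split; first exact: mix_balanced gb hf ad.
by rewrite inE; apply/forallP => u; apply: mix_window gb hf ad.
Qed.

Lemma window_card T u (x : R) :
  x = (2 * rho d T true u + 2 * rho d T false u)%:R
       - (tau T true u + tau T false u)%:R ->
  #|window T u| = 0%N \/ #|window T u|%:R <= M.+1%:R + x.
Proof.
move=> ->.
have : (#|window T u| <= (b + M).+1 + 2 * rho d T true u - tau T false u
          - (b + tau T true u - 2 * rho d T false u))%N.
  by apply: card_ord_window => y; rewrite inE; lia.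
move: (rho d T true u) (rho d T false u) (tau T true u) (tau T false u) => r1 r2 t1 t2 H.
have [|pos] := posnP #|window T u|; [by left|right].
have : (#|window T u| + (t1 + t2) <= M.+1 + (2 * r1 + 2 * r2))%N by lia.
by rewrite -(ler_nat R) !natrD; lra.
Qed.

(** The exchange count is divided by (M + 1)^n; [gain_rho_tau] bounds the exponent of the remaining
    product of relative window sizes. *)
Lemma admissible_count v T : sparse d T ->
  #|[set g in balanced G d b M | `[< admissible d g v T >]]|%:R
    <= #|balanced G d b M|%:R * expR (- (gain T)%:R / (12 * M.+1%:R)) :> R.
Proof.
move=> sp; have M0 : 0 < M.+1%:R :> R by rewrite ltr0n.
have := admissible_count_nat v T; rewrite -(ler_nat R) !natrM natrX.
set E := #|_|%:R; set B := #|_|%:R => H.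
have P0 : 0 < M.+1%:R ^+ n :> R by rewrite exprn_gt0.
rewrite -(ler_pM2r P0); apply: le_trans H _; rewrite -mulrA ler_wpM2l ?ler0n //.
have := prod_window_le (fun u => @window_card T u _ erefl).
move=> /le_trans; apply; rewrite mulrC ler_wpM2r ?(ltW P0) // ler_expR sumrB -!natr_sum.
have := gain_rho_tau hullb sp; rewrite !big_bool /= -!big_split /=.
move: (\sum_(i : G) _)%N (\sum_(i : G) _)%N => x y; rewrite -(ler_nat R) natrD !natrM.
move=> {}H; rewrite ler_pdivrMr //.
have -> : - (gain T)%:R / (12 * M.+1%:R) * M.+1%:R = - (gain T)%:R / 12 :> R.
  by field; rewrite gt_eqF.
by lra.
Qed.

End LocalCounting.

(** * Summation over certificates *)

Section Enumeration.

Local Open Scope ring_scope.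

Variables (R : realType) (G : sgraph) (d b M : nat).
Hypothesis reg : regular_graph G d.
Hypothesis d_gt0 : (0 < d)%N.
Hypothesis hullb : forall X : {set G},
  (20 * #|nbrs X| < 11 * #|G|)%N -> (121 * #|hull d X| <= 25 * #|nbrs X|)%N.

Notation n := #|G|.
Notation phi := {ffun G -> 'I_(2 * b + M).+1}.
Notation family := {ffun 'I_b * bool -> {set G}}.
Implicit Types (g h : phi) (T : family) (u v w : G) (s : bool).

(* As d * mass T <= 100 * gain T, half of the exponent gain / (12 (M + 1)) is at
   least mass T * d / (2400 (M + 1)), that is two units per element of mass. *)
Definition unit_weight : R := expR (- d%:R / (4800 * M.+1%:R)).

Local Notation q := unit_weight.

Hypothesis q_small : 8 * d.+1%:R ^+ 14 * q <= 1.

Definition mass T := (\sum_(k : 'I_b * bool) 2 ^ k.1 * #|T k|)%N.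

Lemma unit_weight_ge0 : 0 <= q. Proof. exact: expR_ge0. Qed.

Lemma unit_weight_le : q <= 1 / 8.
Proof.
have : 1 <= d.+1%:R ^+ 14 :> R by rewrite exprn_ege1 // ler1n.
by have := unit_weight_ge0; move: q_small; nra.
Qed.

Lemma gainE T : gain T = (\sum_(k : 'I_b * bool) 2 ^ k.1 * #|nbrs (T k)|)%N.
Proof.
rewrite /gain exchange_big /= pair_big /=.
by apply: eq_bigr => -[i s] _.
Qed.

Lemma mass_le_gain T : sparse d T -> (d * mass T <= 100 * gain T)%N.
Proof.
move=> /forallP sp; rewrite gainE /mass !big_distrr /=; apply: leq_sum => k _.
rewrite mulnCA [X in (_ <= X)%N]mulnCA leq_mul2l.
by have /andP[w _] := sp k; rewrite [X in _ || X]w orbT.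
Qed.

Lemma support_le_mass T : (#|support T| <= mass T)%N.
Proof.
rewrite /support /mass; apply: (@leq_trans (\sum_k #|T k|)%N).
  elim/big_rec2: _ => [|k m B _ IH]; first by rewrite cards0.
  by apply: leq_trans (leq_card_setU _ _) _; rewrite leq_add2l.
by apply: leq_sum => k _; rewrite leq_pmull // expn_gt0.
Qed.

(** Of the two units per element of mass, one pays for the sets [T k] with weights 2^i, the other is
    weakened from the mass to the size of the support. *)
Lemma expR_gain_le T : sparse d T ->
  expR (- (gain T)%:R / (24 * M.+1%:R)) <=
    q ^+ #|support T| * \prod_(k : 'I_b * bool) (q ^+ (2 ^ k.1)) ^+ #|T k|.
Proof.
move=> sp; have M0 : 0 < M.+1%:R :> R by rewrite ltr0n.
have q1 : q <= 1 by apply: le_trans unit_weight_le _; lra.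
have -> : \prod_(k : 'I_b * bool) (q ^+ (2 ^ k.1)) ^+ #|T k| = q ^+ mass T.
  by rewrite /mass -prodrXr; apply: eq_bigr => k _; rewrite exprM.
apply: (@le_trans _ _ (q ^+ mass T * q ^+ mass T)); last first.
  rewrite ler_wpM2r ?exprn_ge0 ?unit_weight_ge0 //.
  by apply: ler_wiXn2l (support_le_mass T) => //; exact: unit_weight_ge0.
rewrite -expRM_natl -expRD ler_expR.
have := mass_le_gain sp; rewrite -(ler_nat R) !natrM => H.
have -> : - (gain T)%:R / (24 * M.+1%:R) = - (200 * (gain T)%:R) / (4800 * M.+1%:R) :> R.
  by field; rewrite gt_eqF.
have -> : (mass T)%:R * (- d%:R / (4800 * M.+1%:R)) + (mass T)%:R * (- d%:R / (4800 * M.+1%:R))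
    = - (2 * (d%:R * (mass T)%:R)) / (4800 * M.+1%:R) :> R.
  by field; rewrite gt_eqF.
have c0 : 0 < 4800 * M.+1%:R :> R by rewrite -natrM ltr0n.
by rewrite ler_pM2r ?invr_gt0 //; lra.
Qed.

(** [near7] has degree at most (d + 1)^7, so at most (d + 1)^(14m) linked sets have size m + 1;
    [q_small] gives 4q (d + 1)^14 <= 1 / 2, which makes the sum geometric. *)
Lemma sum_linked (v : G) : \sum_(X | linked (@near7 G) v X) (4 * q) ^+ #|X| <= 1.
Proof.
have z0 : 0 <= 4 * q by rewrite mulr_ge0 // unit_weight_ge0.
have Dz : d.+1%:R ^+ 14 * (4 * q) <= 1 / 2 by move: q_small; lra.
have zh : 4 * q <= 1 / 2 by have := unit_weight_le; lra.
move: (4 * q) z0 Dz zh => z z0 Dz zh.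
have deg (a : G) : (#|[set c | near7 a c]| <= d.+1 ^ 7)%N.
  by apply: leq_trans (card_gball 7 a reg); rewrite subset_leq_card //;
    apply/subsetP => x; rewrite inE.
have sym : symmetric (@near7 G).
  by move=> x y; apply/idP/idP; apply: gball_sym.
(* Sets are grouped by size minus one; they contain v, so the predecessor loses no information. *)
rewrite (partition_big (fun X : {set G} => inord #|X|.-1 : 'I_n.+1) predT) //=.
apply: (@le_trans _ _ (\sum_(m < n.+1) (1 / 2) ^+ m.+1)).
  apply: ler_sum => m _.
  rewrite (eq_bigl (fun X => X \in [set X | linked (@near7 G) v X && (#|X| == m.+1)])).
    rewrite (eq_bigr (fun=> z ^+ m.+1)) => [|X]; last by rewrite inE => /andP[_ /eqP ->].
    rewrite sumr_const -[leLHS]mulr_natl.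
    have c : (#|[set X | linked (@near7 G) v X && (#|X| == m.+1)]| <= d.+1 ^ (14 * m))%N.
      apply: leq_trans (card_linked v m sym deg) _.
      by rewrite -expnM -mul2n mulnA leq_pexp2l.
    apply: (@le_trans _ _ (z * (d.+1%:R ^+ 14 * z) ^+ m)).
      rewrite exprMn [z ^+ m.+1]exprS mulrCA ler_wpM2l // ler_wpM2r ?exprn_ge0 //.
      by rewrite -exprM -natrX ler_nat.
    by rewrite [leRHS]exprS ler_pM ?exprn_ge0 ?mulr_ge0 ?exprn_ge0 // lerXn2r ?nnegrE ?mulr_ge0 ?exprn_ge0 //; lra.
  move=> X; rewrite !inE; case lX: (linked _ v X) => //=.
  have X0 : (0 < #|X|)%N by apply/card_gt0P; exists v; case/andP: lX.
  have Xn : (#|X| <= n)%N by exact: max_card.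
  have Xn' : (#|X|.-1 < n.+1)%N by apply: leq_ltn_trans (leq_pred _) _; rewrite ltnS.
  apply/eqP/eqP => [<-|->]; first by rewrite inordK // prednK.
  by apply: val_inj; rewrite /= inordK.
have geo k : \sum_(m < k) (1 / 2) ^+ m.+1 = 1 - (1 / 2) ^+ k :> R.
  elim: k => [|k IH]; first by rewrite big_ord0 expr0 subrr.
  by rewrite big_ord_recr /= IH exprS; lra.
by rewrite geo lerBlDr lerDl exprn_ge0 //; lra.
Qed.

(** Families of subsets of a fixed X contribute at most (1 + 2q)^(2|X|), and q(1 + 2q)^2 <= 4q
    reduces the sum to [sum_linked]. *)
Lemma sum_families (v : G) :
  \sum_(T : family | linked (@near7 G) v (support T))
     (q ^+ #|support T| * \prod_(k : 'I_b * bool) (q ^+ (2 ^ k.1)) ^+ #|T k|) <= 1.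
Proof.
have q0 := unit_weight_ge0; have q8 := unit_weight_le.
apply: le_trans (sum_linked v).
rewrite (partition_big (fun T : family => support T) (linked (@near7 G) v)) //=.
apply: ler_sum => X _.
apply: (@le_trans _ _ (q ^+ #|X| * \sum_(T : family | [forall k, T k \subset X])
     \prod_(k : 'I_b * bool) (q ^+ (2 ^ k.1)) ^+ #|T k|)).
  rewrite mulr_sumr.
  rewrite (eq_bigr (fun T : family => q ^+ #|X| *
      \prod_(k : 'I_b * bool) (q ^+ (2 ^ k.1)) ^+ #|T k|)) => [|T /andP[_ /eqP ->] //].
  apply: ler_sum_sub => [T|T /andP[_ /eqP <-]].
    by rewrite mulr_ge0 ?exprn_ge0 // prodr_ge0 // => k _; rewrite !exprn_ge0.
  by apply/forallP => k; apply: (bigcup_sup k).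
rewrite sum_family_subset prodrXl exprMn mulrC ler_wpM2r ?exprn_ge0 //.
have P0 : 0 <= \prod_(k : 'I_b * bool) (1 + q ^+ (2 ^ k.1)).
  by rewrite prodr_ge0 // => k _; rewrite addr_ge0 ?exprn_ge0.
apply: lerXn2r => //; first by rewrite nnegrE.
have -> : \prod_(k : 'I_b * bool) (1 + q ^+ (2 ^ k.1)) =
    \prod_(i < b) \prod_(s : bool) (1 + q ^+ (2 ^ i)) by rewrite pair_bigA.
rewrite (eq_bigr (fun i : 'I_b => (1 + q ^+ (2 ^ i)) ^+ 2)) => [|i _]; last first.
  by rewrite big_bool /= expr2.
have h : \prod_(i < b) (1 + q ^+ (2 ^ i)) <= 1 + 2 * q.
  by apply: prod_dyadic; rewrite q0 /=; lra.
have h0 : 0 <= \prod_(i < b) (1 + q ^+ (2 ^ i)).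
  by rewrite prodr_ge0 // => i _; rewrite addr_ge0 ?exprn_ge0.
by rewrite prodrXl; nra.
Qed.

(** A union bound over certificates: half of the exponent of [admissible_count] gives the stated
    decay, the other half pays for the enumeration. *)
Lemma local_count (v : G) (g0 : nat) :
  #|[set g in balanced G d b M |
      `[< exists2 T, admissible d g v T & (g0 <= gain T)%N >]]|%:R
    <= #|balanced G d b M|%:R * expR (- g0%:R / (24 * M.+1%:R)) :> R.
Proof.
have M0 : 0 < M.+1%:R :> R by rewrite ltr0n.
pose P (T : family) := [&& linked (@near7 G) v (support T), sparse d T & (g0 <= gain T)%N].
pose E (T : family) := [set g in balanced G d b M | `[< admissible d g v T >]].
apply: (@le_trans _ _ (\sum_(T | P T) #|E T|%:R)).
  rewrite -natr_sum ler_nat; apply: (@leq_trans #|\bigcup_(T | P T) E T|).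
    apply: subset_leq_card; apply/subsetP => g; rewrite inE => /andP[gb /asboolP[T ad gT]].
    apply/bigcupP; exists T; first by rewrite /P gT (adm_sparse ad) (adm_linked ad).
    by rewrite inE gb; apply/asboolP.
  elim/big_rec2: _ => [|k m B _ IH]; first by rewrite cards0.
  by apply: leq_trans (leq_card_setU _ _) _; rewrite leq_add2l.
set B := #|_|%:R; set e := expR _.
apply: (@le_trans _ _ (\sum_(T | P T) B * e * (q ^+ #|support T| *
    \prod_(k : 'I_b * bool) (q ^+ (2 ^ k.1)) ^+ #|T k|))).
  apply: ler_sum => T /and3P[_ sp gT].
  have H := admissible_count R M hullb v sp.
  apply: (le_trans H).
  rewrite -mulrA ler_wpM2l ?ler0n //.
  apply: le_trans (ler_wpM2l (expR_ge0 _) (expR_gain_le sp)).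
  rewrite -expRD ler_expR; move: gT; rewrite -(ler_nat R) => gT.
  have -> : - (gain T)%:R / (12 * M.+1%:R) =
      - (2 * (gain T)%:R) / (24 * M.+1%:R) :> R by field; rewrite gt_eqF.
  by rewrite -mulrDl ler_pM2r ?invr_gt0 ?mulr_gt0 //; lra.
rewrite -mulr_sumr -[leRHS]mulr1 ler_wpM2l ?mulr_ge0 ?ler0n ?expR_ge0 //.
apply: le_trans (sum_families v); apply: ler_sum_sub => [T|T /and3P[]//].
rewrite mulr_ge0 ?exprn_ge0 ?unit_weight_ge0 // prodr_ge0 // => k _.
by rewrite !exprn_ge0 ?unit_weight_ge0.
Qed.

End Enumeration.

(** * Functions without a balanced translate *)

Section StrayFunctions.

Local Open Scope ring_scope.

Variables (R : realType) (G : sgraph) (d b M : nat).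

Notation n := #|G|.
Notation phi := {ffun G -> 'I_(2 * b + M).+1}.
Notation family := {ffun 'I_b * bool -> {set G}}.
Implicit Types (g : phi) (T : family) (U V : {set G}) (u v w : G) (s : bool).

(** The window is lengthened by r: what lies outside it does not spread, but the sets at or beyond
    each of its two ends do. *)
Definition stray (r : nat) : {set phi} :=
  [set g : phi | [&& lip g, ~~ spreading d (lev (M + r) g false 1),
    ~~ spreading d (lev (M + r) g true 1),
    spreading d [set u | (g u <= b)%N] & spreading d [set u | (b + (M + r) <= g u)%N]]].

Record stray_data r g T U V : Prop := StrayData {
  sd_lev : forall s (i : 'I_b), T (i, s) \subset lev (M + r) g s (2 ^ i);
  sd_sparse : sparse d T;
  sd_hull : forall s (i : 'I_b), lev (M + r) g s (2 ^ i) \subset hulls d T s i;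
  sd_low : U \subset [set u | (g u <= b)%N];
  sd_high : V \subset [set u | (b + (M + r) <= g u)%N];
  sd_wide : wide d U && wide d V;
  sd_big : (11 * n <= 20 * #|nbrs U|)%N && (11 * n <= 20 * #|nbrs V|)%N }.

Lemma stray_data_exists r g : (0 < d)%N -> regular_graph G d -> g \in stray r ->
  exists T U V, stray_data r g T U V.
Proof.
move=> d_gt0 reg; rewrite inE => /and5P[lg smf smt].
move=> /existsP[U /and3P[Ul Uw Ub]] /existsP[V /and3P[Vl Vw Vb]].
have small s : ~~ spreading d (lev (M + r) g s 1) by case: s.
(* [cover_exists] takes a vertex as argument, so the empty graph is treated apart. *)
have [v0|v0] := boolP [exists v : G, true]; last first.
  have Ge (A : {set G}) : A = set0.
    by apply/setP => x; move/existsPn: v0 => /(_ x).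
  exists [ffun=> set0], U, V; split; rewrite ?Ul ?Uw ?Vw ?Ub //.
  - by move=> s i; rewrite ffunE sub0set.
  - apply/forallP => -[i s]; rewrite ffunE /wide cards0 muln0 /=.
    have := small s; apply: contraNT; rewrite -leqNgt => H.
    apply/existsP; exists set0; rewrite sub0set /wide cards0 muln0 /=.
    by move: H; rewrite (Ge (nbrs _)).
  - by move=> s i; rewrite (Ge (lev _ _ _ _)) sub0set.
have [v _] := existsP v0.
have [Tf HT] := choice (fun k : 'I_b * bool =>
  cover_exists (lev (M + r) g k.2 (2 ^ k.1)) v d_gt0 reg).
exists [ffun k => Tf k], U, V.
have lev' s (i : 'I_b) : [ffun k => Tf k] (i, s) \subset lev (M + r) g s (2 ^ i).
  by rewrite ffunE; have [] := HT (i, s).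
split; rewrite ?Ul ?Uw ?Vw ?Ub //.
- apply/forallP => -[i s]; apply/andP; split; first by rewrite ffunE; have [] := HT (i, s).
  apply: sparse_of_small (small s) _ (lev' s i).
  by rewrite ffunE; have [] := HT (i, s).
- by move=> s i; rewrite /hulls ffunE; have [] := HT (i, s).
Qed.

Definition stray_window r T U V u : {set 'I_(2 * b + M).+1} :=
  [set x : 'I_(2 * b + M).+1 |
    (x + tau T false u + r * (u \in nbrs U) <= b + (M + r) + 2 * rho d T true u)%N &&
    (b + tau T true u + r * (u \in nbrs V) <= x + 2 * rho d T false u)%N].

(** A positive [tau] already confines g u relative to an M-step from the lengthened window's end, at
    distance r inside the other end. The losses from [tau] and from U or V can therefore be deducted
    together. *)
Lemma stray_in_window r g T U V u : lip g -> stray_data r g T U V ->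
  g u \in stray_window r T U V u.
Proof.
move=> lg sd; rewrite inE.
have hrho s : (dep (M + r) g s u <= 2 * rho d T s u)%N.
  by apply: dep_rho; [exact: leq_addr|move=> i; apply: (subsetP (sd_hull sd s i))].
have := hrho true; have := hrho false; rewrite /dep => rf rt.
have tf : (0 < tau T false u -> g u + tau T false u <= b + M)%N.
  exact: (tau_false lg (sd_lev sd)).
have tt : (0 < tau T true u -> b + (M + r) + tau T true u <= g u + M)%N.
  exact: (tau_true lg (sd_lev sd)).
have lo : (u \in nbrs U -> g u <= b + M)%N.
  move=> /nbrsP[t tU tu]; have := subsetP (sd_low sd) t tU; rewrite inE.
  by rewrite adj_sym in tu; have := lipP _ lg _ _ tu; lia.
have hi : (u \in nbrs V -> b + (M + r) <= g u + M)%N.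
  move=> /nbrsP[t tV tu]; have := subsetP (sd_high sd) t tV; rewrite inE.
  by have := lipP _ lg _ _ tu; lia.
move: tf tt lo hi; case: (u \in nbrs U); case: (u \in nbrs V) => /=;
  by do 2 (case: posnP => [->|_]); lia.
Qed.

(* Compared with M + 1, the window gains r and loses r for each of U and V whose
   neighbourhood contains u; on average this is a loss of at least r / 10. *)
Lemma stray_window_card r T U V u (x : R) :
  x = r%:R + (2 * rho d T true u + 2 * rho d T false u)%:R
       - (tau T true u + tau T false u)%:R
       - (r * (u \in nbrs U) + r * (u \in nbrs V))%:R ->
  #|stray_window r T U V u| = 0%N \/ #|stray_window r T U V u|%:R <= M.+1%:R + x.
Proof.
move=> ->.
have : (#|stray_window r T U V u| <= (b + (M + r)).+1 + 2 * rho d T true u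
            - (tau T false u + r * (u \in nbrs U))
          - (b + tau T true u + r * (u \in nbrs V) - 2 * rho d T false u))%N.
  by apply: card_ord_window => y; rewrite inE; lia.
move: (rho d T true u) (rho d T false u) (tau T true u) (tau T false u) => r1 r2 t1 t2.
move: (r * (u \in nbrs U))%N (r * (u \in nbrs V))%N => a c H.
have [|pos] := posnP #|stray_window r T U V u|; [by left|right].
have : (#|stray_window r T U V u| + (t1 + t2) + (a + c)
          <= M.+1 + r + (2 * r1 + 2 * r2))%N by lia.
by rewrite -(ler_nat R) !natrD; lra.
Qed.

Hypothesis hullb : forall X : {set G},
  (20 * #|nbrs X| < 11 * #|G|)%N -> (121 * #|hull d X| <= 25 * #|nbrs X|)%N.

(** The r deducted on [nbrs U] and on [nbrs V] totals at least 11rn / 10, against a gain of rn from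
    the longer window. No resampling takes place: the count is compared with (M + 1)^n. *)
Lemma stray_data_count r T U V : sparse d T ->
  (11 * n <= 20 * #|nbrs U|)%N && (11 * n <= 20 * #|nbrs V|)%N ->
  #|[set g in stray r | `[< stray_data r g T U V >]]|%:R
    <= M.+1%:R ^+ n * expR (- (r * n)%:R / (10 * M.+1%:R)) *
         expR (- (gain T)%:R / (12 * M.+1%:R)) :> R.
Proof.
move=> sp /andP[bU bV]; have M0 : 0 < M.+1%:R :> R by rewrite ltr0n.
apply: (@le_trans _ _ (\prod_u #|stray_window r T U V u|)%:R).
  rewrite ler_nat -card_windows; apply: subset_leq_card; apply/subsetP => g.
  rewrite inE => /andP[gs /asboolP sd]; rewrite inE; apply/forallP => u.
  by apply: stray_in_window sd; move: gs; rewrite inE => /and5P[].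
apply: le_trans (prod_window_le (fun u => @stray_window_card r T U V u _ erefl)) _.
rewrite -mulrA ler_wpM2l ?exprn_ge0 ?ler0n // -expRD ler_expR.
have sumr : \sum_(u : G) r%:R = (r * n)%:R :> R by rewrite sumr_const natrM mulr_natr.
rewrite !sumrB big_split /= sumr -!natr_sum.
have sumU (A : {set G}) : (\sum_(u : G) r * (u \in A) = r * #|A|)%N.
  by rewrite -big_distrr -big_mkcond /= sum1_card.
rewrite [X in _ - X%:R]big_split /= !sumU.
have := gain_rho_tau hullb sp; rewrite !big_bool /= -!big_split /=.
move: (\sum_(i : G) _)%N (\sum_(i : G) _)%N => x y xy.
have : 12 * y%:R + (gain T)%:R <= 12 * x%:R :> R by rewrite -!natrM -natrD ler_nat.
move=> xyR.
rewrite ler_pdivrMr // mulrDl.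
have -> : - (gain T)%:R / (12 * M.+1%:R) * M.+1%:R = - (gain T)%:R / 12 :> R.
  by field; rewrite gt_eqF.
have -> : - (r * n)%:R / (10 * M.+1%:R) * M.+1%:R = - (r * n)%:R / 10 :> R.
  by field; rewrite gt_eqF.
have : (11 * (r * n) <= 20 * (r * #|nbrs U|))%N by rewrite mulnCA [leqRHS]mulnCA leq_mul2l bU orbT.
have : (11 * (r * n) <= 20 * (r * #|nbrs V|))%N by rewrite mulnCA [leqRHS]mulnCA leq_mul2l bV orbT.
by rewrite -!(ler_nat R) natrD !natrM; lra.
Qed.

Hypothesis reg : regular_graph G d.
Hypothesis d_gt0 : (0 < d)%N.
Hypothesis M_le_d : (M <= d)%N.
Hypothesis q_small : 8 * d.+1%:R ^+ 14 * unit_weight R d M <= 1.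

Local Notation q := (unit_weight R d M).

Lemma unit_weight_small : 240 * M.+1%:R * q <= 1.
Proof.
have q0 := unit_weight_ge0 R d M; apply: le_trans q_small; rewrite ler_wpM2r //.
rewrite [_ ^+ 14]exprS mulrA.
have d2 : 2 <= d.+1%:R :> R by rewrite ler_nat.
have : 2 ^+ 13 <= d.+1%:R ^+ 13 :> R by apply: lerXn2r; rewrite ?nnegrE ?ler0n.
have : M.+1%:R <= d.+1%:R :> R by rewrite ler_nat.
have : 0 <= M.+1%:R :> R by rewrite ler0n.
have -> : 2 ^+ 13 = 8192 :> R by ring.
move: (d.+1%:R ^+ 13) => y m0 mD y0.
have : d.+1%:R * 8192 <= d.+1%:R * y by rewrite ler_wpM2l ?ler0n.
by rewrite -mulrA; lra.
Qed.

(** Width gives d|U| <= 100n, so encoding U uses up at most a share rn / (40(M + 1)) of the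
    exponent. *)
Lemma wide_weight r U : (0 < r)%N -> wide d U ->
  expR (- (r * n)%:R / (40 * M.+1%:R)) <= q ^+ #|U|.
Proof.
move=> r0 wU; rewrite -expRM_natl ler_expR.
have M0 : 0 < M.+1%:R :> R by rewrite ltr0n.
have h : (d * #|U| <= 100 * (r * n))%N.
  apply: leq_trans wU _; rewrite leq_mul2l /=; apply: leq_trans (max_card _) _.
  by rewrite leq_pmull.
have -> : - (r * n)%:R / (40 * M.+1%:R) = - (120 * (r * n)%:R) / (4800 * M.+1%:R) :> R.
  by field; rewrite gt_eqF.
rewrite mulrA; have c0 : 0 < 4800 * M.+1%:R :> R by rewrite -natrM ltr0n.
rewrite ler_pM2r ?invr_gt0 //; have : 0 <= (r * n)%:R :> R by rewrite ler0n.
by move: h; rewrite -(ler_nat R) !natrM; lra.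
Qed.

(** The share 1 / 10 splits as 1 / 20 + 1 / 40 + 1 / 40, the last two paying for U and V. Summing
    all weights costs exp(6qn) <= exp(n / (40(M + 1))), which leaves 1 / 20 - 1 / 40 = 1 / 40. *)
Lemma stray_count r : (0 < r)%N ->
  #|stray r|%:R <= M.+1%:R ^+ n * expR (- n%:R / (40 * M.+1%:R)) :> R.
Proof.
move=> r0; have M0 : 0 < M.+1%:R :> R by rewrite ltr0n.
have q0 := unit_weight_ge0 R d M; have q8 := unit_weight_le q_small.
pose P (p : family * ({set G} * {set G})) :=
  [&& sparse d p.1, wide d p.2.1, wide d p.2.2,
      (11 * n <= 20 * #|nbrs p.2.1|)%N & (11 * n <= 20 * #|nbrs p.2.2|)%N].
pose E (p : family * ({set G} * {set G})) :=
  [set g in stray r | `[< stray_data r g p.1 p.2.1 p.2.2 >]].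
pose w (p : family * ({set G} * {set G})) : R :=
  (\prod_(k : 'I_b * bool) (q ^+ (2 ^ k.1)) ^+ #|p.1 k|) * (q ^+ #|p.2.1| * q ^+ #|p.2.2|).
set e : R := expR (- (r * n)%:R / (20 * M.+1%:R)).
apply: (@le_trans _ _ (\sum_(p | P p) #|E p|%:R)).
  rewrite -natr_sum ler_nat; apply: (@leq_trans #|\bigcup_(p | P p) E p|).
    apply: subset_leq_card; apply/subsetP => g gs.
    have [T [U [V sd]]] := stray_data_exists d_gt0 reg gs.
    apply/bigcupP; exists (T, (U, V)); last by rewrite inE gs; apply/asboolP.
    rewrite /P /= (sd_sparse sd) /=.
    by have /andP[-> ->] := sd_wide sd; have /andP[-> ->] := sd_big sd.
  elim/big_rec2: _ => [|k m B _ IH]; first by rewrite cards0.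
  by apply: leq_trans (leq_card_setU _ _) _; rewrite leq_add2l.
apply: (@le_trans _ _ (\sum_p M.+1%:R ^+ n * e * w p)).
  apply: (@le_trans _ _ (\sum_(p | P p) M.+1%:R ^+ n * e * w p)); last first.
    apply: ler_sum_sub => // p.
    rewrite !mulr_ge0 ?exprn_ge0 ?expR_ge0 ?ler0n // prodr_ge0 // => k _.
    by rewrite !exprn_ge0.
  apply: ler_sum => -[T [U V]] /and5P[/= sp wU wV bU bV].
  have H := stray_data_count r sp (introT andP (conj bU bV)).
  apply: (le_trans H); rewrite -!mulrA ler_wpM2l ?exprn_ge0 ?ler0n //.
  have -> : expR (- (r * n)%:R / (10 * M.+1%:R)) = e *
      (expR (- (r * n)%:R / (40 * M.+1%:R)) * expR (- (r * n)%:R / (40 * M.+1%:R))).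
    by rewrite -!expRD; congr expR; field; rewrite gt_eqF.
  rewrite -!mulrA ler_wpM2l ?expR_ge0 // /w /= mulrA [leRHS]mulrC.
  apply: ler_pM; rewrite ?mulr_ge0 ?expR_ge0 //.
    by apply: ler_pM; rewrite ?expR_ge0 ?wide_weight.
  apply: (@le_trans _ _ (expR (- (gain T)%:R / (24 * M.+1%:R)))).
    rewrite ler_expR ler_pdivlMr ?mulr_gt0 //.
    have -> : - (gain T)%:R / (12 * M.+1%:R) * (24 * M.+1%:R) = - (2 * (gain T)%:R) :> R.
      by field; rewrite gt_eqF.
    by have : 0 <= (gain T)%:R :> R by []; lra.
  apply: le_trans (expR_gain_le q_small sp) _.
  rewrite -[leRHS]mul1r ler_wpM2r ?prodr_ge0 // ?exprn_ile1 //; last lra.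
  by move=> k _; rewrite !exprn_ge0.
have sumq : \sum_(U : {set G}) q ^+ #|U| = (1 + q) ^+ n.
  by rewrite -cardsT -sum_set_expr; apply: eq_bigl => U; rewrite subsetT.
have sumT : \sum_(T : family) \prod_(k : 'I_b * bool) (q ^+ (2 ^ k.1)) ^+ #|T k|
    <= ((1 + 2 * q) ^+ 2) ^+ n.
  rewrite (eq_bigl (fun T : family => [forall k, T k \subset setT])); last first.
    by move=> T; symmetry; apply/forallP => k; apply: subsetT.
  rewrite sum_family_subset prodrXl cardsT.
  have -> : \prod_(k : 'I_b * bool) (1 + q ^+ (2 ^ k.1)) =
      \prod_(i < b) \prod_(s : bool) (1 + q ^+ (2 ^ i)) by rewrite pair_bigA.
  rewrite (eq_bigr (fun i : 'I_b => (1 + q ^+ (2 ^ i)) ^+ 2)) => [|i _]; last first.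
    by rewrite big_bool /= expr2.
  have h : \prod_(i < b) (1 + q ^+ (2 ^ i)) <= 1 + 2 * q.
    by apply: prod_dyadic; rewrite q0 /=; lra.
  have h0 : 0 <= \prod_(i < b) (1 + q ^+ (2 ^ i)).
    by rewrite prodr_ge0 // => i _; rewrite addr_ge0 ?exprn_ge0.
  have q2 : 0 <= 1 + 2 * q by lra.
  have h2 := lerXn2r 2 h0 q2 h.
  by rewrite prodrXl; apply: lerXn2r h2; rewrite nnegrE exprn_ge0.
rewrite -mulr_sumr; have -> : \sum_p w p =
    (\sum_(T : family) \prod_(k : 'I_b * bool) (q ^+ (2 ^ k.1)) ^+ #|T k|)
      * (((1 + q) ^+ n) * ((1 + q) ^+ n)).
  rewrite -sumq [X in _ = _ * X]big_distrlr /= pair_bigA /= big_distrlr /= pair_bigA.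
  by apply: eq_bigr.
rewrite -mulrA ler_wpM2l ?exprn_ge0 ?ler0n //.
apply: (@le_trans _ _ (e * expR (6 * q * n%:R))).
  rewrite ler_wpM2l ?expR_ge0 //.
  apply: (@le_trans _ _ (((1 + 2 * q) ^+ 2) ^+ n * ((1 + q) ^+ n * (1 + q) ^+ n))).
    by apply: ler_wpM2r sumT; rewrite mulr_ge0 // exprn_ge0 // addr_ge0.
  rewrite [leLHS](_ : _ = ((1 + 2 * q) ^+ 2 * ((1 + q) * (1 + q))) ^+ n); last first.
    by rewrite !exprMn.
  rewrite expRM_natr; apply: lerXn2r.
  - by rewrite nnegrE !mulr_ge0 ?exprn_ge0 ?addr_ge0 ?mulr_ge0.
  - by rewrite nnegrE expR_ge0.
  have -> : expR (6 * q) = expR (2 * q) * expR (2 * q) * (expR q * expR q).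
    by rewrite -!expRD; congr expR; ring.
  have q2 : 0 <= 1 + 2 * q by lra.
  have q1 : 0 <= 1 + q by lra.
  have e1 : 1 + q <= expR q by apply: expR_ge1Dx.
  have e2 : 1 + 2 * q <= expR (2 * q) by apply: expR_ge1Dx.
  have q21 := ler_pM q2 q2 e2 e2; have q11 := ler_pM q1 q1 e1 e1.
  by rewrite expr2; apply: ler_pM q21 q11; apply: mulr_ge0.
rewrite -expRD ler_expR.
have n0 : 0 <= n%:R :> R by rewrite ler0n.
have rn : n%:R <= (r * n)%:R :> R by rewrite ler_nat leq_pmull.
have qn : 6 * q * n%:R * (40 * M.+1%:R) <= n%:R.
  have -> : 6 * q * n%:R * (40 * M.+1%:R) = n%:R * (240 * M.+1%:R * q) by ring.
  by rewrite ler_piMr // unit_weight_small.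
have c0 : 0 < 40 * M.+1%:R :> R by rewrite -natrM ltr0n.
rewrite ler_pdivlMr // mulrDl.
have -> : - (r * n)%:R / (20 * M.+1%:R) * (40 * M.+1%:R) = - 2 * (r * n)%:R :> R.
  by field; rewrite gt_eqF.
by lra.
Qed.

End StrayFunctions.

Lemma shifted_levels (x b m : nat) (y k : int) : (x%:Z = b%:Z + y - k)%R ->
  [/\ (0 < b - x) = (y < k)%R, (0 < x - (b + m)) = (k + m%:Z < y)%R,
      (x <= b) = (y <= k)%R & (b + m <= x) = (k + m%:Z <= y)%R].
Proof. by move=> ?; split; apply/idP/idP; lia. Qed.

(** * Pinned functions *)

Section Transfer.

Variables (G : sgraph) (d M : nat) (v0 : G).
Hypothesis conn : connected_graph G.

Notation n := #|G|.
Notation b := (M * n).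
Notation phi := {ffun G -> 'I_(2 * b + M).+1}.
Implicit Types (a : {ffun G -> int}) (g : phi) (k : int).

Definition lipseq : seq {ffun G -> int} := fset_set (Lip v0 M).

Lemma mem_lipseq a : (a \in lipseq) <-> Lip v0 M a.
Proof.
have fin := finite_Lip v0 M conn.
have -> : (a \in lipseq) = (a \in Lip v0 M) by rewrite -(in_fset_set fin).
by rewrite in_setE.
Qed.

Lemma uniq_lipseq : uniq lipseq.
Proof. exact: fset_uniq. Qed.

Lemma card_vertex_gt0 : 0 < n.
Proof. by apply/card_gt0P; exists v0. Qed.

Lemma lip_diameter a u w :
  (forall x y, adj x y -> (`|a x - a y| <= M%:Z)%R) -> (`|a u - a w| <= b%:Z)%R.
Proof.
move=> la; have /connectP[p0 pth0 ->] := conn u w.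
have [p pth up _] := shortenP pth0.
have sz : size p <= n.
  by apply: leq_trans (max_card (mem (u :: p))); rewrite (card_uniqP up) /=.
suff H : (`|a u - a (last u p)| <= (M * size p)%:Z)%R.
  by apply: le_trans H _; rewrite lez_nat leq_mul2l sz orbT.
elim: p u pth {up sz pth0 p0 w} => [|x p IH] u /=; first by rewrite subrr normr0 muln0.
case/andP=> ux px; have := IH x px; have := la u x ux; rewrite mulnS PoszD.
by move: (a (last x p)) (a u) (a x) (Posz (M * size p)) => *; lia.
Qed.

(** A function with values in [0, M] is determined by its translate pinned at [v0] and its value
    there. *)
Lemma card_flat_le : M.+1 ^ n <= M.+1 * size lipseq.
Proof.
pose f (h : {ffun G -> 'I_M.+1}) : {ffun G -> int} * 'I_M.+1 :=
  ([ffun u => (h u)%:Z - (h v0)%:Z]%R, h v0).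
have -> : M.+1 * size lipseq = size [seq (x, y) | x <- lipseq, y <- enum 'I_M.+1].
  by rewrite size_allpairs size_enum_ord mulnC.
have <- : #|{ffun G -> 'I_M.+1}| = M.+1 ^ n by rewrite card_ffun card_ord.
rewrite cardE -(size_map f); apply: uniq_leq_size.
  rewrite map_inj_uniq ?enum_uniq // => h h' E.
  have /ffunP E1 := congr1 fst E; have E2 : h v0 = h' v0 := congr1 snd E.
  by apply/ffunP => u; apply: val_inj; have := E1 u; rewrite !ffunE E2 /=; lia.
move=> _ /mapP[h _ ->]; apply: allpairs_f; last by rewrite mem_enum.
apply/mem_lipseq; split=> [|u w uw]; rewrite !ffunE; first by rewrite subrr.
have := ltn_ord (h u); have := ltn_ord (h w).
by move: (nat_of_ord (h u)) (nat_of_ord (h w)) (nat_of_ord (h v0)) => x y z; lia.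
Qed.

Hypothesis reg : regular_graph G d.
Hypothesis d_gt0 : 0 < d.
Hypothesis hullb : forall X : {set G},
  20 * #|nbrs X| < 11 * #|G| -> 121 * #|hull d X| <= 25 * #|nbrs X|.

(** A is inside a hull of size at most (25 / 121)(11 / 20)n = 5n / 44 < n / 8. *)
Lemma small_card (A : {set G}) : ~~ spreading d A -> 8 * #|A| <= n.
Proof.
move=> smA; have [T [TA wT AT _]] := cover_exists A v0 d_gt0 reg.
have F : 20 * #|nbrs T| < 11 * n.
  rewrite ltnNge; apply: contra smA => H.
  by apply/existsP; exists T; rewrite TA wT.
by have := hullb F; have := subset_leq_card AT; lia.
Qed.

Lemma not_spreading0 : ~~ spreading d (set0 : {set G}).
Proof.
apply/existsP => -[T]; rewrite subset0 => /and3P[/eqP -> _].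
by rewrite /nbrs big_set0 cards0 muln0 leqn0 muln_eq0 /= -leqn0 leqNgt card_vertex_gt0.
Qed.

Definition good a k : bool :=
  ~~ spreading d [set u | (a u < k)%R] && ~~ spreading d [set u | (k + M%:Z < a u)%R].

Definition emb a k : phi := [ffun u => inord (absz (b%:Z + a u - k)%R)].

Lemma emb_val a k u : Lip v0 M a ->
  (exists u, (a u <= k + M%:Z)%R) -> (exists w, (k <= a w)%R) ->
  ((emb a k u)%:Z = b%:Z + a u - k)%R.
Proof.
move=> [_ la] [x xk] [w wk].
have := lip_diameter u x la; have := lip_diameter u w la => h1 h2.
by rewrite ffunE inordK; lia.
Qed.

(** Both functions vanish at [v0], so the value there reveals k = k'. *)
Lemma emb_inj a a' k k' : Lip v0 M a -> Lip v0 M a' ->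
  (forall u, ((emb a k u)%:Z = b%:Z + a u - k)%R) ->
  (forall u, ((emb a' k' u)%:Z = b%:Z + a' u - k')%R) ->
  emb a k = emb a' k' -> a = a'.
Proof.
move=> [a0 _] [a0' _] H H' E; apply/ffunP => u.
have := H u; have := H v0; rewrite E (H' u) (H' v0) a0 a0'; lia.
Qed.

Lemma emb_lip a k : Lip v0 M a ->
  (forall u, ((emb a k u)%:Z = b%:Z + a u - k)%R) -> lip (emb a k).
Proof.
move=> [_ la] H; apply/lipP => u w uw.
by have := la u w uw; have := H u; have := H w; lia.
Qed.

Lemma good_inhabited a k : good a k -> exists u, (k <= a u <= k + M%:Z)%R.
Proof.
case/andP => /small_card h1 /small_card h2.
have [/existsP[u hu]|/existsPn H] := boolP [exists u, (k <= a u <= k + M%:Z)%R].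
  by exists u.
have : n <= #|[set u | (a u < k)%R] :|: [set u | (k + M%:Z < a u)%R]|.
  rewrite -cardsT; apply: subset_leq_card; apply/subsetP => u _.
  by have := H u; rewrite !inE; case: ltP; case: ltP.
move=> /leq_trans/(_ (leq_card_setU _ _)); have := card_vertex_gt0; lia.
Qed.

Lemma emb_good a k u : Lip v0 M a -> good a k -> ((emb a k u)%:Z = b%:Z + a u - k)%R.
Proof.
move=> la /good_inhabited[x /andP[x1 x2]].
by apply: emb_val; [|exists x|exists x].
Qed.

Lemma emb_balanced a k : Lip v0 M a -> good a k -> emb a k \in balanced G d b M.
Proof.
move=> la gk; have H u := emb_good u la gk; have /andP[g1 g2] := gk.
rewrite inE (emb_lip la H) /=; apply/andP; split.
  have -> : lev M (emb a k) false 1 = [set u | (a u < k)%R].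
    by apply/setP => u; rewrite !inE /dep; have := H u; lia.
  by [].
have -> : lev M (emb a k) true 1 = [set u | (k + M%:Z < a u)%R].
  by apply/setP => u; rewrite !inE /dep; have := H u; lia.
by [].
Qed.

Definition has_good a : bool := `[< exists k, good a k >].
Definition ground a : int := xget 0%R [set k | good a k]%classic.

Lemma groundP a : has_good a -> good a (ground a).
Proof. by move/asboolP => H; apply: (xgetPex 0%R H). Qed.

Lemma sum_good_le (R : realType) (F : phi -> R) : (forall g, 0 <= F g)%R ->
  (\sum_(a <- lipseq | has_good a) F (emb a (ground a))
     <= \sum_(g in balanced G d b M) F g)%R.
Proof.
move=> F0; rewrite -big_filter -(big_map (fun a => emb a (ground a)) predT F).
rewrite big_uniq; last first.
  rewrite map_inj_in_uniq ?filter_uniq ?uniq_lipseq // => a a'.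
  rewrite !mem_filter => /andP[ga /mem_lipseq la] /andP[ga' /mem_lipseq la'].
  by apply: emb_inj => // u; apply: emb_good => //; apply: groundP.
apply: ler_sum_sub => // g /mapP[a]; rewrite mem_filter => /andP[ga /mem_lipseq la] ->.
by apply: emb_balanced => //; apply: groundP.
Qed.

(* Two balanced translates of the same function both lie in the window at some
   common vertex, so they differ by at most M. *)
Lemma card_balanced_le : #|balanced G d b M| <= M.+1 * size lipseq.
Proof.
pose f (g : phi) : {ffun G -> int} * 'I_M.+1 :=
  ([ffun u => (g u)%:Z - (g v0)%:Z]%R, inord (g v0 %% M.+1)).
have -> : M.+1 * size lipseq = size [seq (x, y) | x <- lipseq, y <- enum 'I_M.+1].
  by rewrite size_allpairs size_enum_ord mulnC.
rewrite cardE -(size_map f); apply: uniq_leq_size.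
  rewrite map_inj_in_uniq ?enum_uniq // => g g'; rewrite !mem_enum !inE.
  move=> /and3P[_ s1 s2] /and3P[_ s3 s4] E.
  have /ffunP E1 := congr1 fst E; have := congr1 (fun p => val p.2) E => /=.
  rewrite !inordK ?ltn_mod // => E2.
  have aux x y z : ~~ ((z <= x <= z + M) && (z <= y <= z + M)) ->
      (0 < z - x) || (0 < x - (z + M)) || ((0 < z - y) || (0 < y - (z + M))) by lia.
  have aux2 m x y z t : 0 < m -> 8 * x <= m -> 8 * y <= m -> 8 * z <= m -> 8 * t <= m ->
      m <= x + y + (z + t) -> false by lia.
  (* Four sets of at most n / 8 vertices cannot cover G. *)
  have [u hu] : exists u, (b <= g u <= b + M) && (b <= g' u <= b + M).
    apply/existsP; apply: contraT => /existsPn H.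
    have /subset_leq_card : [set: G] \subset (lev M g false 1 :|: lev M g true 1)
                    :|: (lev M g' false 1 :|: lev M g' true 1).
      apply/subsetP => u _; have := H u; rewrite !inE /dep /=.
      exact: aux.
    rewrite cardsT => /leq_trans/(_ (leq_card_setU _ _)).
    move=> /leq_trans/(_ (leq_add (leq_card_setU _ _) (leq_card_setU _ _))).
    exact: aux2 card_vertex_gt0 (small_card s1) (small_card s2) (small_card s3) (small_card s4).
  have Eu w : ((g w)%:Z - (g v0)%:Z = (g' w)%:Z - (g' v0)%:Z)%R.
    by have := E1 w; rewrite !ffunE.
  (* The two values agree modulo M + 1 and differ by at most M. *)
  have e0 : (g v0 : nat) = g' v0.
    have := divn_eq (g v0) M.+1; have := divn_eq (g' v0) M.+1; have := Eu u.
    move: hu; rewrite E2; move: (g v0 %/ _) (g' v0 %/ _) (g' v0 %% _) => x y z.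
    have [xy|xy|->] := ltngtP x y; last by lia.
    - have h : x.+1 * M.+1 <= y * M.+1 by rewrite leq_mul2r xy orbT.
      by rewrite mulSn in h; move=> *; lia.
    - have h : y.+1 * M.+1 <= x * M.+1 by rewrite leq_mul2r xy orbT.
      by rewrite mulSn in h; move=> *; lia.
  by apply/ffunP => w; apply: val_inj => /=; have := Eu w; rewrite e0 => /addIr [].
move=> p /mapP[g]; rewrite mem_enum inE => /and3P[lg _ _] ->.
apply: allpairs_f; last by rewrite mem_enum.
apply/mem_lipseq; split=> [|u w uw]; rewrite !ffunE; first by rewrite subrr.
have := lipP _ lg u w uw; have := lipP _ lg w u; rewrite adj_sym => /(_ uw).
lia.
Qed.

(** Take the last k for which {a < k} does not spread. As k is not good, {a > k + M} spreads; r is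
    the largest number for which {a >= k + M + r} still does. *)
Lemma stray_exists a : Lip v0 M a -> ~~ has_good a ->
  exists k r, [/\ forall u, ((emb a k u)%:Z = b%:Z + a u - k)%R,
    0 < r <= b & emb a k \in stray G d b M r].
Proof.
move=> la ng; have [a0 la'] := la.
(* All values of a lie in [-b, b], so the search starts at -b, where the set is empty. *)
pose P j := spreading d [set u | (a u < - b%:Z + j%:Z)%R].
have ab u : (`|a u| <= b%:Z)%R by rewrite -[a u]subr0 -a0; apply: lip_diameter.
have exP : exists j, P j.
  exists (2 * b).+1; apply: contraT => /small_card.
  have -> : [set u | (a u < - b%:Z + (2 * b).+1%:Z)%R] = setT.
    by apply/setP => u; rewrite !inE; have := ab u; lia.
  by rewrite cardsT; have := card_vertex_gt0; lia.
case: (ex_minnP exP) => -[|j] Pj minj.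
  have E : [set u | (a u < - b%:Z + 0%:Z)%R] = set0.
    by apply/setP => u; rewrite !inE; have := ab u; lia.
  by move: Pj; rewrite /P E (negbTE not_spreading0).
pose k := (- b%:Z + j%:Z)%R.
have smk : ~~ spreading d [set u | (a u < k)%R].
  by apply/negP => /minj; rewrite ltnn.
have bigk : spreading d [set u | (a u <= k)%R].
  by apply: spreadingS Pj; apply/subsetP => u; rewrite !inE /k; lia.
have bigM : spreading d [set u | (k + M%:Z < a u)%R].
  apply: contraT => H; case/negP: ng; apply/asboolP; exists k.
  by rewrite /good smk H.
pose Q r := spreading d [set u | (k + (M + r)%:Z <= a u)%R].
have big_mem (A : {set G}) : spreading d A -> exists u, u \in A.
  move=> H; apply/set0Pn; apply: contraL H => /eqP ->; exact: not_spreading0.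
have [x] := big_mem _ bigk; rewrite inE => xk.
have exQ : exists r, Q r.
  by exists 1; apply: spreadingS bigM; apply/subsetP => u; rewrite !inE; lia.
have Qb r : Q r -> r <= b.
  move=> /big_mem[u]; rewrite inE => uk; have := lip_diameter u x la'; lia.
case: (ex_maxnP exQ Qb) => r Qr maxr.
have r1 : 0 < r.
  by apply: maxr; apply: spreadingS bigM; apply/subsetP => u; rewrite !inE; lia.
have [y] := big_mem _ bigM; rewrite inE => yk.
have H u : ((emb a k u)%:Z = b%:Z + a u - k)%R.
  by apply: emb_val => //; [exists x; lia|exists y; lia].
exists k, r; split=> //; first by rewrite r1 Qb.
have lv m u := shifted_levels m (H u).
rewrite inE (emb_lip la H) /=; apply/and4P; split.
- apply: contra smk; apply: spreadingS; apply/subsetP => u; rewrite !inE /dep.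
  by have [-> _ _ _] := lv 0 u.
- have : ~~ Q r.+1 by apply/negP => /maxr; rewrite ltnn.
  apply: contra; apply: spreadingS; apply/subsetP => u; rewrite !inE /dep.
  by have [_ -> _ _] := lv (M + r) u; rewrite addnS; lia.
- by apply: spreadingS bigk; apply/subsetP => u; rewrite !inE; have [_ _ -> _] := lv 0 u.
- by apply: spreadingS Qr; apply/subsetP => u; rewrite !inE; have [_ _ _ ->] := lv (M + r) u.
Qed.

Lemma count_no_good :
  count (fun a => ~~ has_good a) lipseq <= \sum_(r < b) #|stray G d b M r.+1|.
Proof.
have ex a : exists k, Lip v0 M a -> ~~ has_good a ->
    (forall u, ((emb a k u)%:Z = b%:Z + a u - k)%R) /\
    (exists2 r : 'I_b, true & emb a k \in stray G d b M r.+1).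
  have [[la ng]|H] := pselect (Lip v0 M a /\ ~~ has_good a); last first.
    by exists 0%R => la ng; case: H.
  have [k [r [Hk /andP[r0 rb] rs]]] := stray_exists la ng.
  exists k => _ _; split=> //.
  case: r r0 rb rs => // r _ rb rs; exists (Ordinal rb) => //.
have [kf Hk] := choice ex.
rewrite -size_filter -(size_map (fun a => emb a (kf a))).
apply: (@leq_trans #|\bigcup_(r < b) stray G d b M r.+1|); last first.
  elim/big_rec2: _ => [|k m B _ IH]; first by rewrite cards0.
  by apply: leq_trans (leq_card_setU _ _) _; rewrite leq_add2l.
rewrite cardE; apply: uniq_leq_size.
  rewrite map_inj_in_uniq ?filter_uniq ?uniq_lipseq // => a a'.
  rewrite !mem_filter => /andP[ga /mem_lipseq la] /andP[ga' /mem_lipseq la'].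
  by apply: emb_inj => //; [have [] := Hk _ la ga|have [] := Hk _ la' ga'].
move=> p /mapP[a]; rewrite mem_filter => /andP[ga /mem_lipseq la] ->.
have [_ [r _ rs]] := Hk _ la ga.
by rewrite mem_enum; apply/bigcupP; exists r.
Qed.

Lemma dep_abs a u : Lip v0 M a -> has_good a ->
  (`|a u| <= M%:Z + (dep M (emb a (ground a)) false u
     + dep M (emb a (ground a)) true u + dep M (emb a (ground a)) false v0
     + dep M (emb a (ground a)) true v0)%:Z)%R.
Proof.
move=> la ga; have := emb_good u la (groundP ga).
have := emb_good v0 la (groundP ga); have [-> _] := la.
by rewrite /dep; lia.
Qed.

(** The range is at most M + 1 plus the depths of the maximum above and of the minimum below the
    window; the larger depth is counted twice. *)
Lemma range_dep a : Lip v0 M a -> has_good a -> exists v s,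
  (lip_range v0 a <= M.+1%:Z + (2 * dep M (emb a (ground a)) s v)%:Z)%R.
Proof.
move=> la ga.
have [x hx] : exists x, \big[Order.max/a v0]_(v : G) a v = a x.
  elim/big_ind: _ => [|i j [x ->] [y ->]|i _]; [by exists v0| |by exists i].
  by case: (leP (a x) (a y)) => _; [exists y|exists x].
have [y hy] : exists y, \big[Order.min/a v0]_(v : G) a v = a y.
  elim/big_ind: _ => [|i j [x' ->] [y ->]|i _]; [by exists v0| |by exists i].
  by case: (leP (a x') (a y)) => _; [exists x'|exists y].
have := emb_good x la (groundP ga); have := emb_good y la (groundP ga).
rewrite /lip_range hx hy; set g := emb _ _ => gy gx.
have [h|h] := leqP (dep M g false y) (dep M g true x); [exists x, true|exists y, false].
  by move: h; rewrite /dep; lia.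
by move: h; rewrite /dep; lia.
Qed.

End Transfer.

(** * The numerical regime *)

Section Regime.

Local Open Scope ring_scope.

Variable R : realType.

Lemma ln2_bounds : 1 / 2 <= ln (2 : R) <= 1.
Proof.
have h1 : ln (1 + 1) <= 1 :> R by apply: le_ln1Dx; lra.
have h2 : ln (1 + - (1 / 2)) <= - (1 / 2) :> R by apply: le_ln1Dx; lra.
have E : 1 + - (1 / 2) = 2^-1 :> R by field.
by move: h1 h2; rewrite E lnV ?posrE // -[1 + 1]/(2); lra.
Qed.

Lemma log2_ge (x : R) : 1 <= x -> ln x <= log2 x.
Proof.
move=> x1; have /andP[l1 l2] := ln2_bounds; have := ln_ge0 x1 => h.
by rewrite /log2 ler_pdivlMr; [nra|lra].
Qed.

Lemma ln_ge_log2 (x : R) : 1 <= x -> log2 x <= 2 * ln x.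
Proof.
move=> x1; have /andP[l1 l2] := ln2_bounds; have := ln_ge0 x1 => h.
by rewrite /log2 ler_pdivrMr; [nra|lra].
Qed.

Lemma expR_quartic (x : R) : 0 <= x -> x ^+ 4 <= 24 * expR x.
Proof.
move=> x0; have := expR_ge1Dxn 3 x0.
rewrite (_ : 4`! = 24%N) //.
have h : 0 <= x ^+ 4 by rewrite exprn_ge0.
by lra.
Qed.

Lemma expR_quadratic (x : R) : 0 <= x -> x ^+ 2 <= 2 * expR x.
Proof.
move=> x0; have := expR_ge1Dxn 1 x0.
rewrite (_ : 2`! = 2%N) //.
have h : 0 <= x ^+ 2 by rewrite exprn_ge0.
by lra.
Qed.

Variables (G : sgraph) (M n d : nat) (lambda : R) (v0 : G).
Hypothesis M_gt0 : (0 < M)%N.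
Hypothesis expG : expander G n d lambda.
Hypothesis lambda_le : lambda <= d%:R / 5.
Local Notation c := (expR (- 2000) : R).
Hypothesis d_le : d%:R / 5 <= c * n%:R.
Hypothesis M_le1 : M%:R <= c * (d%:R `^ (3 / 2) / (lambda * log2 d%:R)).
Hypothesis M_le2 : M%:R <= log2 n%:R :> R.

(** exp 2000 >= 2000^2 / 2 = 2000000, while 20 * 4800 * 16 = 1536000. *)
Lemma constant_small : c * (20 * 4800 * 16) <= 1.
Proof.
have h := @expR_quadratic 2000 (ler0n _ _).
have e0 : 0 < expR 2000 :> R by exact: expR_gt0.
by rewrite expRN ler_pdivrMl // mulr1; lra.
Qed.

(** For d <= 1 the logarithm is 0, also by convention at d = 0, and division by 0 gives 0; the bound
    on M would read M <= 0. *)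
Lemma degree_gt1 : (1 < d)%N.
Proof.
have Mp : 0 < M%:R :> R by rewrite ltr0n.
rewrite ltnNge; apply/negP => d1; have := lt_le_trans Mp M_le1.
have -> : log2 (d%:R : R) = 0.
  have [|] : d = 0%N \/ d = 1%N by lia.
    by move=> ->; rewrite /log2 ln0 ?mul0r.
  by move=> ->; rewrite /log2 ln1 mul0r.
by rewrite mulr0 invr0 !mulr0 ltxx.
Qed.

Lemma degree_lt_card : (d < n)%N.
Proof.
have [cG reg _] := expG; rewrite -(reg v0) -cG.
have : [set u | adj v0 u] \subset [set~ v0].
  by apply/subsetP => u; rewrite !inE; apply: contraTneq => ->; rewrite adj_irrefl.
move=> /subset_leq_card; rewrite cardsC1 => H; apply: leq_ltn_trans H _.
by rewrite ltn_predL; apply/card_gt0P; exists v0.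
Qed.

Local Notation D := (d%:R : R).

(** Mixing between [v0] and its neighbourhood gives d - d^2 / n <= lambda sqrt d, and d <= n / 2. *)
Lemma lambda_ge : Num.sqrt D / 2 <= lambda.
Proof.
have [cG reg mix] := expG; have := mix [set v0] (nbr v0).
rewrite e_betweenE big_set1 setIid [#|nbr v0|]reg cards1 mulr1 mul1r.
have D0 : 0 < D by rewrite ltr0n (ltn_trans _ degree_gt1).
have n0 : 0 < n%:R :> R by rewrite ltr0n (leq_ltn_trans _ degree_lt_card).
have s0 : 0 < Num.sqrt D by rewrite sqrtr_gt0.
have ss : D = Num.sqrt D * Num.sqrt D by rewrite -expr2 sqr_sqrtr // ltW.
have c1 : c * 10 <= 1 by have := constant_small; have := expR_gt0 (-2000 : R); lra.
have dn : D / n%:R * D <= D / 2.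
  have cn : c * 10 * n%:R <= n%:R by rewrite ler_piMl // ltW.
  by rewrite [leRHS]mulrC ler_wpM2r ?(ltW D0) // ler_pdivrMr //; move: d_le; lra.
move=> /(le_trans (ler_norm _)) H.
have : Num.sqrt D * (Num.sqrt D / 2) <= Num.sqrt D * lambda.
  by rewrite mulrA -ss [leRHS]mulrC; lra.
by rewrite ler_pM2l.
Qed.

Lemma lambda_gt0 : 0 < lambda.
Proof.
have D0 : 0 < D by rewrite ltr0n (ltn_trans _ degree_gt1).
by apply: lt_le_trans lambda_ge; rewrite divr_gt0 // sqrtr_gt0.
Qed.

Lemma M_log2_le : M%:R * log2 D <= 2 * c * D.
Proof.
have D1 : 1 < D by rewrite ltr1n degree_gt1.
have D0 : 0 < D by lra.
have lD : 0 < log2 D.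
  by rewrite divr_gt0 ?ln_gt0 // ltr1n.
have s0 : 0 < Num.sqrt D by rewrite sqrtr_gt0.
have l0 := lambda_gt0.
have E : D `^ (3 / 2) = D * Num.sqrt D.
  have -> : 3 / 2 = 1 + 2^-1 :> R by field.
  rewrite powRD; last by rewrite (gt_eqF D0) implybT.
  by rewrite powRr1 ?(ltW D0) // powR12_sqrt ?(ltW D0).
have lamD : 0 < lambda * log2 D by rewrite mulr_gt0.
have := M_le1; rewrite E mulrA ler_pdivlMr // => H.
have M0 : 0 <= M%:R :> R by rewrite ler0n.
have H2 : M%:R * log2 D * (Num.sqrt D / 2) <= M%:R * log2 D * lambda.
  by apply: ler_wpM2l lambda_ge; rewrite mulr_ge0 // ltW.
have : Num.sqrt D * (M%:R * log2 D) <= Num.sqrt D * (2 * c * D).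
  by move: H H2; lra.
by rewrite ler_pM2l.
Qed.

Lemma ln_d_le : M.+1%:R * ln D * (20 * 4800) <= D.
Proof.
have D1 : 1 <= D by rewrite ler1n (ltnW degree_gt1).
have h := M_log2_le; have l1 := log2_ge D1; have l0 := ln_ge0 D1.
have M1 : 1 <= M%:R :> R by rewrite ler1n.
have h2 : M.+1%:R <= 2 * M%:R :> R by rewrite -natr1; lra.
have h3 : M.+1%:R * ln D <= 2 * M%:R * log2 D by apply: ler_pM => //; rewrite ler0n.
have cD : c * (20 * 4800 * 16) * D <= D by rewrite ler_piMl ?constant_small //; lra.
by lra.
Qed.

(** With M >= 1 and log d >= 1, [M_log2_le] forces d >= exp 2000 / 2. *)
Lemma degree_ge_expR : expR 1998 <= D.
Proof.
have D2 : 2 <= D by rewrite ler_nat degree_gt1.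
have lD : 1 <= log2 D.
  rewrite ler_pdivlMr ?mul1r ?ln_gt0 ?ltr1n //.
  by rewrite ler_ln ?posrE //; lra.
have M1 : 1 <= M%:R :> R by rewrite ler1n.
have h : 1 <= 2 * c * D by apply: le_trans M_log2_le; nra.
have e2 : 2 <= expR 2 :> R by have := expR_ge1Dx (2 : R); lra.
have -> : (1998 : R) = - (-2000 + 2) by ring.
have e0 := expR_gt0 (- 2000 + 2 : R).
rewrite expRN -[leLHS]mul1r ler_pdivrMr // expRD; have := expR_gt0 (-2000 : R).
by nra.
Qed.

Lemma ln_n_large : 1998 <= ln (n%:R : R).
Proof.
have h := degree_ge_expR; have e := expR_gt0 (1998 : R).
rewrite -(expRK 1998) ler_ln ?posrE //; last by rewrite ltr0n (leq_ltn_trans _ degree_lt_card).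
by apply: le_trans h _; rewrite ler_nat ltnW ?degree_lt_card.
Qed.

Lemma lipschitz_le_degree : (M <= d)%N.
Proof.
rewrite -(ler_nat R); have := ln_d_le; have h : 1 <= ln D.
  have := degree_ge_expR; rewrite -ler_ln ?posrE ?expR_gt0 ?ltr0n ?(ltn_trans _ degree_gt1) // expRK.
  by apply: le_trans; rewrite ler1n.
have M0 : 0 <= M%:R :> R by rewrite ler0n.
by rewrite -natr1; nra.
Qed.

(** [ln_d_le] makes the unit weight at most d^(-20); then 8(2d)^14 <= d^20 since d is huge. *)
Lemma unit_weight_bound : 8 * d.+1%:R ^+ 14 * unit_weight R d M <= 1.
Proof.
have D0 : 0 < D by rewrite ltr0n (ltn_trans _ degree_gt1).
have M0 : 0 < M.+1%:R :> R by rewrite ltr0n.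
have c0 : 0 < 4800 * M.+1%:R :> R by rewrite -natrM ltr0n.
have : unit_weight R d M <= expR (- (20%:R * ln D)).
  rewrite ler_expR mulNr lerN2 ler_pdivlMr //; have := ln_d_le; lra.
rewrite expRN expRM_natl lnK ?posrE // => H.
have D6 : 8 * 2 ^+ 14 <= D ^+ 6.
  apply: (@le_trans _ _ (1000 ^+ 6)); first by lra.
  apply: lerXn2r; rewrite ?nnegrE ?ler0n //.
  by apply: le_trans degree_ge_expR; have := expR_ge1Dx (1998 : R); lra.
apply: (@le_trans _ _ (8 * (2 * D) ^+ 14 * D ^- 20)).
  apply: ler_pM => //; first exact: unit_weight_ge0.
  have D1 : 1 <= D by rewrite ler1n (ltnW degree_gt1).
  have D2 : d.+1%:R <= 2 * D by rewrite -natr1; lra.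
  by rewrite ler_wpM2l // lerXn2r ?nnegrE ?mulr_ge0 ?ler0n.
rewrite exprMn mulrA ler_pdivrMr ?exprn_gt0 // mul1r.
have -> : D ^+ 20 = D ^+ 6 * D ^+ 14 by rewrite -exprD.
by rewrite ler_wpM2r ?exprn_ge0 ?(ltW D0).
Qed.

Local Notation y := (log2 (n%:R : R)).

Lemma card_ge1 : 1 <= n%:R :> R.
Proof. by rewrite ler1n (leq_ltn_trans _ degree_lt_card). Qed.

Lemma log2_card_ge : 1998 <= y.
Proof. exact: le_trans ln_n_large (log2_ge card_ge1). Qed.

Lemma lipschitz_le_log2 : M.+1%:R <= 2 * y.
Proof. by have := M_le2; have := log2_card_ge; rewrite -natr1; lra. Qed.

(** M + 1 is at most 4 ln n, so the claim reduces to 1280 (ln n)^2 <= n, a consequence of n >= (ln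
    n)^4 / 24. *)
Lemma expR_n_small : expR (- n%:R / (40 * M.+1%:R)) <= (n%:R ^+ 8)^-1 :> R.
Proof.
have n1 := card_ge1; have n0 : 0 < n%:R :> R by lra.
have M0 : 0 < M.+1%:R :> R by rewrite ltr0n.
rewrite -[in leRHS](lnK (x := n%:R)) ?posrE // -expRM_natl -expRN ler_expR.
rewrite mulNr lerN2 ler_pdivlMr ?mulr_gt0 //.
have q := expR_quartic (ln_ge0 n1); rewrite lnK ?posrE // in q.
have lb := ln_n_large; have My := lipschitz_le_log2; have y2 := ln_ge_log2 n1.
set l := ln _ in q lb y2 *.
have h1 : 8 * l * (40 * M.+1%:R) <= 8 * l * (40 * (4 * l)) by apply: ler_wpM2l; lra.
have h2 : 1998 * 1998 <= l ^+ 2 by rewrite expr2; apply: ler_pM; lra.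
have h3 : 1998 * 1998 * l ^+ 2 <= l ^+ 2 * l ^+ 2 by rewrite ler_wpM2r // sqr_ge0.
apply: le_trans h1 _; have -> : 8 * l * (40 * (4 * l)) = 1280 * l ^+ 2 by ring.
by rewrite -exprD in h3; lra.
Qed.

(** As lambda >= sqrt d / 2, the hypothesis gives log n < 2 sqrt d, so sqrt d exceeds 999 and d
    dominates 384 ln n. *)
Lemma expR_d_small : y < d%:R / lambda ->
  expR (- D / 96) <= (n%:R ^+ 4)^-1 :> R.
Proof.
move=> yd; have n1 := card_ge1; have n0 : 0 < n%:R :> R by lra.
rewrite -[in leRHS](lnK (x := n%:R)) ?posrE // -expRM_natl -expRN ler_expR.
rewrite mulNr lerN2 ler_pdivlMr //.
have D0 : 0 < D by rewrite ltr0n (ltn_trans _ degree_gt1).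
have s0 : 0 < Num.sqrt D by rewrite sqrtr_gt0.
have l0 := lambda_gt0; have lg := lambda_ge.
have ss : D = Num.sqrt D ^+ 2 by rewrite sqr_sqrtr // ltW.
have ys : y < 2 * Num.sqrt D.
  have h : y * lambda < D by rewrite -ltr_pdivlMr.
  have y0 := log2_card_ge.
  have h2 : y * (Num.sqrt D / 2) <= y * lambda by rewrite ler_wpM2l //; lra.
  have h' : y * lambda < Num.sqrt D * Num.sqrt D by rewrite -expr2 -ss.
  have : Num.sqrt D * y < Num.sqrt D * (2 * Num.sqrt D) by lra.
  by rewrite ltr_pM2l.
have ly := log2_ge n1; have yl := log2_card_ge.
have : 999 * Num.sqrt D <= D by rewrite [leRHS]ss expr2 ler_wpM2r ?sqrtr_ge0 //; lra.
by lra.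
Qed.

(** The condition on j says (d / lambda)^j >= (log n)^3, whereas 192 (log n)^2 would suffice. *)
Lemma expR_growth_small (j : nat) :
  3 * (log2 y / log2 (d%:R / lambda)) <= j%:R ->
  expR (- (d%:R / lambda) ^+ j / (24 * M.+1%:R)) <= (n%:R ^+ 4)^-1 :> R.
Proof.
move=> hj; have n1 := card_ge1; have n0 : 0 < n%:R :> R by lra.
have l0 := lambda_gt0; have yl := log2_card_ge.
have M0 : 0 < M.+1%:R :> R by rewrite ltr0n.
have x5 : 5 <= d%:R / lambda by rewrite ler_pdivlMr //; move: lambda_le; lra.
have x0 : 0 < d%:R / lambda by lra.
have /andP[l2 _] := ln2_bounds.
have lx : 0 < log2 (d%:R / lambda) by rewrite divr_gt0 ?ln_gt0 //; lra.
have big : y ^+ 3 <= (d%:R / lambda) ^+ j.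
  rewrite -ler_ln ?posrE ?exprn_gt0 //; last lra.
  rewrite !lnXn //; last lra.
  move: hj; rewrite mulrA ler_pdivrMr // /log2 mulrA [leRHS]mulrA ler_pM2r ?invr_gt0; last lra.
  by rewrite !mulr_natl.
rewrite -[in leRHS](lnK (x := n%:R)) ?posrE // -expRM_natl -expRN ler_expR.
rewrite mulNr lerN2 ler_pdivlMr ?mulr_gt0 //; apply: le_trans big.
have My := lipschitz_le_log2; have ly := log2_ge n1; have := ln_ge0 n1 => ln0.
have : 4 * ln n%:R * (24 * M.+1%:R) <= 4 * y * (24 * (2 * y)).
  by apply: ler_pM; rewrite ?mulr_ge0 ?ler0n //; lra.
by move=> h; apply: le_trans h _; rewrite !exprS expr0; nra.
Qed.

End Regime.

Lemma half_succ_le m x : m.+1 <= 2 * x -> m./2.+1 <= x.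
Proof. by have := odd_double_half m; lia. Qed.

Lemma le_double_half_succ m : m.+1 <= 2 * m./2.+1.
Proof. by have := odd_double_half m; lia. Qed.

Lemma natr_card_pred (R : realType) (T : finType) (A : {set T}) (P : pred T) :
  (#|[set x in A | P x]|%:R = \sum_(x in A) (P x)%:R :> R)%R.
Proof.
rewrite -sum1_card natr_sum big_mkcond [RHS]big_mkcond /=.
by apply: eq_bigr => x _; rewrite inE; case: (x \in A); case: (P x).
Qed.

(** * Tail and moment bounds *)

Section Tails.

Local Open Scope ring_scope.

Variables (R : realType) (G : sgraph) (M n d : nat) (lambda : R) (v0 : G).
Hypothesis expG : expander G n d lambda.
Hypothesis lambda_gt0 : 0 < lambda.
Hypothesis lambda_le : lambda <= d%:R / 5.
Hypothesis d_gt0 : (0 < d)%N.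
Hypothesis M_gt0 : (0 < M)%N.
Hypothesis M_le_d : (M <= d)%N.
Hypothesis q_small : 8 * d.+1%:R ^+ 14 * unit_weight R d M <= 1.
Hypothesis conn : connected_graph G.

Notation b := (M * #|G|)%N.
Notation phi := {ffun G -> 'I_(2 * b + M).+1}.
Notation q := (unit_weight R d M).
Notation S := (lipseq M v0).
Notation L := ((size S)%:R : R).
Notation B := ((#|balanced G d b M|)%:R : R).
Implicit Types (g : phi) (u v : G) (s : bool).

Lemma expander_card : #|G| = n. Proof. by have [] := expG. Qed.
Lemma expander_regular : regular_graph G d. Proof. by have [] := expG. Qed.

Local Notation cardG := expander_card.
Local Notation reg := expander_regular.

Lemma expander_hull (X : {set G}) :
  (20 * #|nbrs X| < 11 * #|G|)%N -> (121 * #|hull d X| <= 25 * #|nbrs X|)%N.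
Proof. by rewrite cardG; apply: hull_card expG d_gt0 lambda_le X. Qed.

Lemma balanced_le : B <= M.+1%:R * L.
Proof. by rewrite -natrM ler_nat; apply: (card_balanced_le M v0 conn reg d_gt0 expander_hull). Qed.

Lemma lipseq_gt0 : 0 < L.
Proof.
rewrite ltr0n -(ltn_pmul2l (ltn0Sn M)) muln0.
by apply: leq_trans (card_flat_le M v0 conn); rewrite expn_gt0.
Qed.

Lemma gain_tail v (g0 : nat) (P : pred phi) :
  (forall g, g \in balanced G d b M -> P g ->
     exists2 T, admissible d g v T & (g0 <= gain T)%N) ->
  #|[set g in balanced G d b M | P g]|%:R <= B * expR (- g0%:R / (24 * M.+1%:R)).
Proof.
move=> H; apply: le_trans (local_count b reg expander_hull q_small v g0).
rewrite ler_nat; apply: subset_leq_card; apply/subsetP => g.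
by rewrite inE => /andP[gb /(H g gb) ex]; rewrite inE gb; apply/asboolP.
Qed.

(** Rounding r down to a power of 2 loses a factor 2, whence 48 in place of 24. *)
Lemma dep_tail v s r : (0 < r)%N ->
  #|[set g in balanced G d b M | (r <= dep M g s v)%N]|%:R
    <= B * expR (- (r * d)%:R / (48 * M.+1%:R)).
Proof.
move=> r0; have M0 : 0 < M.+1%:R :> R by rewrite ltr0n.
have /andP[lo hi] := trunc_log_bounds (leqnn 2) r0; set i := trunc_log 2 r in lo hi.
apply: le_trans (gain_tail (v := v) (g0 := 2 ^ i * d) _) _ => [g gb rd|].
  have dv : (0 < dep M g s v)%N by apply: leq_trans rd.
  have [T [ad big _]] := admissible_exists reg d_gt0 expander_hull gb dv.
  have ib : (i < b)%N.
    rewrite -(ltn_exp2l _ _ (leqnn 2)); apply: leq_ltn_trans lo _.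
    apply: leq_ltn_trans rd _; apply: leq_ltn_trans (dep_le g s v (leqnn M)) _.
    exact: ltn_expl.
  by exists T => //; apply: (big (Ordinal ib)); apply: leq_trans lo rd.
rewrite ler_wpM2l ?ler0n // ler_expR.
have -> : - (2 ^ i * d)%:R / (24 * M.+1%:R) = - (2 * (2 ^ i * d)%:R) / (48 * M.+1%:R) :> R.
  by field; rewrite gt_eqF.
have c0 : 0 < 48 * M.+1%:R :> R by rewrite -natrM ltr0n.
rewrite ler_pM2r ?invr_gt0 // lerN2 -natrM ler_nat mulnA -expnS leq_mul2r.
by rewrite (ltnW hi) orbT.
Qed.

Lemma deep_tail v s j :
  #|[set g in balanced G d b M | (j * M < dep M g s v)%N]|%:R
    <= B * expR (- (d%:R / lambda) ^+ j / (24 * M.+1%:R)).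
Proof.
have M0 : 0 < M.+1%:R :> R by rewrite ltr0n.
set E := [set g in _ | _].
(* One g in E is enough to bound the iterated neighbourhoods of v, which do not depend on g;
   [nbrs_growth] then applies to each of them. *)
have [E0|[g]] := set_0Vmem E.
  by rewrite E0 cards0 mulr_ge0 ?ler0n ?expR_ge0.
rewrite inE => /andP[gb gd].
pose Z i := iter i (@nbrs G) [set v].
have [T [ad _ Zs]] := admissible_exists reg d_gt0 expander_hull gb (leq_ltn_trans (leq0n _) gd).
have growth i : (i <= j)%N -> (d%:R / lambda) ^+ i <= #|Z i|%:R.
  elim: i => [|i IH] ij; first by rewrite expr0 cards1.
  have iM : (i.+1 * M < dep M g s v)%N.
    by apply: leq_ltn_trans gd; rewrite leq_mul2r ij orbT.
  have [_] := Zs _ iM; rewrite cardG => /(nbrs_growth expG d_gt0 lambda_le) h.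
  apply: le_trans h; rewrite exprS.
  by rewrite ler_wpM2l ?divr_ge0 ?ler0n ?(ltW lambda_gt0) // IH // ltnW.
apply: le_trans (gain_tail (v := v) (g0 := #|Z j|) _) _ => [g' gb' gd'|].
  have [T' [ad' _ Zs']] := admissible_exists reg d_gt0 expander_hull gb' (leq_ltn_trans (leq0n _) gd').
  by exists T' => //; have [] := Zs' j gd'.
rewrite ler_wpM2l ?ler0n // ler_expR ler_pM2r ?invr_gt0 ?mulr_gt0 //.
by rewrite lerN2 growth.
Qed.

(** The sum equals 2^(x+1) - 2. This turns a second moment into a geometrically weighted sum of
    tails. *)
Lemma square_le_sum_exp2 (x m : nat) : (x <= m)%N ->
  (x ^ 2 <= \sum_(r < m) 2 ^ r.+1 * (r < x))%N.
Proof.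
move=> xm; apply: (@leq_trans (\sum_(r < x) 2 ^ r.+1)%N).
  suff H : (x ^ 2 + 2 <= \sum_(r < x) 2 ^ r.+1 + 2)%N by rewrite leq_add2r in H.
  have -> : (\sum_(r < x) 2 ^ r.+1 + 2 = 2 ^ x.+1)%N.
    elim: (x) => [|k IH]; first by rewrite big_ord0.
    by rewrite big_ord_recr /= addnAC IH [RHS]expnS mul2n -addnn.
  elim: (x) => [//|k IH]; rewrite [(2 ^ k.+2)%N]expnS mul2n -addnn.
  case: k IH => [//|k] IH; apply: leq_trans (leq_add IH IH).
  by rewrite -!mulnn; nia.
rewrite (big_ord_widen m (fun r => 2 ^ r.+1)%N xm) [leqLHS]big_mkcond.
by apply: leq_sum => r _; case: ltnP => _; rewrite ?muln1.
Qed.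

Lemma geometric_le (x : R) m : 0 <= x <= 1 / 2 -> \sum_(r < m) x ^+ r.+1 <= 2 * x.
Proof.
move=> /andP[x0 x1]; suff : \sum_(r < m) x ^+ r.+1 + 2 * x ^+ m.+1 <= 2 * x.
  by apply: le_trans; rewrite lerDl mulr_ge0 // exprn_ge0.
elim: m => [|m IH]; first by rewrite big_ord0 add0r expr1.
rewrite big_ord_recr /=; apply: le_trans IH; rewrite -addrA lerD2l.
rewrite [x ^+ m.+2]exprS; have := exprn_ge0 m.+1 x0.
by move: (x ^+ m.+1) => z z0; nra.
Qed.

(** Each tail is at most B q^(r+1), so the moment is at most 4qB; [balanced_le] and 240(M + 1)q <= 1
    conclude. *)
Lemma dep_moment v s :
  \sum_(g in balanced G d b M) ((dep M g s v)%:R : R) ^+ 2 <= L / 60.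
Proof.
have q0 : 0 <= q := unit_weight_ge0 R d M.
have q8 := unit_weight_le q_small; have M0 : 0 < M.+1%:R :> R by rewrite ltr0n.
apply: (@le_trans _ _ (\sum_(g in balanced G d b M) \sum_(r < b)
    2 ^+ r.+1 * (r < dep M g s v)%N%:R)).
  apply: ler_sum => g _; rewrite -natrX.
  have := square_le_sum_exp2 (dep_le g s v (leqnn M)); rewrite -(ler_nat R).
  move=> /le_trans; apply; rewrite natr_sum ler_sum // => r _.
  by rewrite natrM natrX.
rewrite exchange_big /=; apply: (@le_trans _ _ (\sum_(r < b) B * (2 * q) ^+ r.+1)).
  apply: ler_sum => r _; rewrite -mulr_sumr exprMn mulrCA ler_wpM2l ?exprn_ge0 //.
  apply: le_trans (le_trans (dep_tail v s (ltn0Sn r)) _).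
    by rewrite natr_card_pred.
  rewrite ler_wpM2l ?ler0n // -expRM_natl ler_expR.
  have -> : - (r.+1 * d)%:R / (48 * M.+1%:R) = 100 * (r.+1%:R * (- d%:R / (4800 * M.+1%:R))) :> R.
    by rewrite natrM; field; rewrite gt_eqF.
  have : r.+1%:R * (- d%:R / (4800 * M.+1%:R)) <= 0 :> R.
    have c0 : 0 < 4800 * M.+1%:R :> R by rewrite -natrM ltr0n.
    apply: mulr_ge0_le0; first exact: ler0n.
    by rewrite mulNr oppr_le0; apply: divr_ge0; [exact: ler0n|exact: ltW c0].
  by move: (r.+1%:R * (- d%:R / (4800 * M.+1%:R)) : R) => x x0; lra.
rewrite -mulr_sumr; apply: (@le_trans _ _ (B * (2 * (2 * q)))).
  by rewrite ler_wpM2l ?ler0n // geometric_le //; lra.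
apply: (@le_trans _ _ (M.+1%:R * L * (4 * q))).
  rewrite [X in B * X](_ : _ = 4 * q); last by ring.
  by apply: ler_wpM2r balanced_le; apply: mulr_ge0.
have h := unit_weight_small d_gt0 M_le_d q_small.
have -> : M.+1%:R * L * (4 * q) = L / 60 * (240 * M.+1%:R * q) by field.
by rewrite ler_piMr // divr_ge0 // ltW ?lipseq_gt0.
Qed.

Lemma bad_count :
  (count (fun a => ~~ has_good d M a) S)%:R <=
    b%:R * M.+1%:R * L * expR (- #|G|%:R / (40 * M.+1%:R)).
Proof.
set e := expR _; have e0 : 0 < e by apply: expR_gt0.
have h := count_no_good M v0 conn reg d_gt0 expander_hull; rewrite -(ler_nat R) in h.
apply: (le_trans h); rewrite natr_sum.
apply: (@le_trans _ _ (\sum_(r < b) M.+1%:R ^+ #|G| * e)).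
  by apply: ler_sum => r _; apply: stray_count reg d_gt0 M_le_d q_small _ _ => //; exact: expander_hull.
rewrite sumr_const card_ord -[leLHS]mulr_natl -!mulrA ler_wpM2l ?ler0n // mulrA.
rewrite ler_wpM2r ?(ltW e0) // -natrX -natrM ler_nat.
exact: card_flat_le M v0 conn.
Qed.

(** Good functions contribute at most 5M^2 L + L / 3 by [dep_abs] and [dep_moment]. The others have
    values at most b in absolute value and contribute at most L. *)
Lemma second_moment u :
  b%:R ^+ 3 * M.+1%:R * expR (- #|G|%:R / (40 * M.+1%:R)) <= 1 :> R ->
  \sum_(a <- S) ((a u)%:~R : R) ^+ 2 <= 7 * M%:R ^+ 2 * L.
Proof.
move=> hb; have L0 := lipseq_gt0.
have M1 : 1 <= M%:R ^+ 2 :> R by rewrite -natrX ler1n expn_gt0 M_gt0.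
pose D2 (g : phi) s w : R := (dep M g s w)%:R ^+ 2.
rewrite (bigID (has_good d M)) /=.
have H1 : \sum_(a <- S | has_good d M a) ((a u)%:~R : R) ^+ 2 <=
    5 * M%:R ^+ 2 * L + 5 * (4 * (L / 60)).
  apply: (@le_trans _ _ (\sum_(a <- S | has_good d M a) (5 * M%:R ^+ 2 +
      5 * (D2 (emb M a (ground d M a)) false u + D2 (emb M a (ground d M a)) true u
       + D2 (emb M a (ground d M a)) false v0 + D2 (emb M a (ground d M a)) true v0)))).
    rewrite big_seq_cond [leRHS]big_seq_cond; apply: ler_sum => a /andP[/(mem_lipseq M v0 conn) la ga].
    have := dep_abs conn reg d_gt0 expander_hull u la ga; rewrite /D2.
    move: (dep _ _ _ _) (dep _ _ _ _) (dep _ _ _ _) (dep _ _ _ _) => x4 x3 x2 x1.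
    rewrite -(ler_int R) intr_norm rmorphD /= -!pmulrn !natrD => h.
    rewrite -[leLHS]real_normK ?num_real //.
    apply: (@le_trans _ _ ((M%:R + (x1%:R + x2%:R + x3%:R + x4%:R)) ^+ 2)).
      by apply: lerXn2r h; rewrite ?nnegrE ?addr_ge0 ?ler0n.
    move: (M%:R) (x1%:R) (x2%:R) (x3%:R) (x4%:R) => m y1 y2 y3 y4.
    (* Cauchy-Schwarz for five terms, as a sum of ten squared differences. *)
    have := sqr_ge0 (m - y1); have := sqr_ge0 (m - y2); have := sqr_ge0 (m - y3).
    have := sqr_ge0 (m - y4); have := sqr_ge0 (y1 - y2); have := sqr_ge0 (y1 - y3).
    have := sqr_ge0 (y1 - y4); have := sqr_ge0 (y2 - y3); have := sqr_ge0 (y2 - y4).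
    by have := sqr_ge0 (y3 - y4); rewrite !expr2; lra.
  rewrite big_split /=; apply: lerD.
    rewrite big_const_seq iter_addr addr0 -[leLHS]mulr_natr ler_wpM2l ?mulr_ge0 ?exprn_ge0 ?ler0n //.
    by rewrite ler_nat count_size.
  rewrite -mulr_sumr ler_wpM2l //.
  have F0 g : 0 <= D2 g false u + D2 g true u + D2 g false v0 + D2 g true v0.
    by rewrite !addr_ge0 // exprn_ge0 // ler0n.
  apply: le_trans (sum_good_le v0 conn reg d_gt0 expander_hull F0) _.
  rewrite !big_split /=.
  have := dep_moment u false; have := dep_moment u true.
  have := dep_moment v0 false; have := dep_moment v0 true; rewrite /D2.
  by lra.
have H2 : \sum_(a <- S | ~~ has_good d M a) ((a u)%:~R : R) ^+ 2 <= L.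
  apply: (@le_trans _ _ (\sum_(a <- S | ~~ has_good d M a) b%:R ^+ 2)).
    rewrite big_seq_cond [leRHS]big_seq_cond; apply: ler_sum => a /andP[/(mem_lipseq M v0 conn) [a0 la] _].
    have := lip_diameter conn u v0 la; rewrite a0 subr0 -(ler_int R) intr_norm => h.
    by rewrite -[leLHS]real_normK ?num_real //; apply: lerXn2r => //; rewrite ?nnegrE ?ler0n.
  rewrite big_const_seq iter_addr addr0 -[leLHS]mulr_natl.
  apply: le_trans (ler_wpM2r _ bad_count) _; first by rewrite exprn_ge0 ?ler0n.
  set e := expR _ in hb *.
  have -> : b%:R * M.+1%:R * L * e * b%:R ^+ 2 = b%:R ^+ 3 * M.+1%:R * e * L by ring.
  by rewrite ler_piMl // ltW.
have : L <= M%:R ^+ 2 * L by rewrite ler_peMl // ltW.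
by move: H1 H2; lra.
Qed.

Lemma range_count (t : R) (h : nat) :
  (forall x : nat, t <= M.+1%:R + 2 * x%:R -> (h <= x)%N) ->
  (count (fun a => t <= (lip_range v0 a)%:~R) S)%:R <=
    (count (fun a => ~~ has_good d M a) S)%:R +
    \sum_v \sum_s #|[set g in balanced G d b M | (h <= dep M g s v)%N]|%:R :> R.
Proof.
move=> ht.
pose F (g : phi) : R := \sum_v \sum_s (h <= dep M g s v)%N%:R.
have F0 g : 0 <= F g by rewrite /F sumr_ge0 // => v _; rewrite sumr_ge0.
have -> : \sum_v \sum_s #|[set g in balanced G d b M | (h <= dep M g s v)%N]|%:R
    = \sum_(g in balanced G d b M) F g.
  rewrite /F [RHS]exchange_big; apply: eq_bigr => v _; rewrite [RHS]exchange_big; apply: eq_bigr => s _.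
  exact: natr_card_pred.
have := sum_good_le v0 conn reg d_gt0 expander_hull F0 => le.
rewrite addrC; apply: le_trans (lerD le (lexx _)).
rewrite -!sum1_count !natr_sum [leLHS](bigID (has_good d M)) /=; apply: lerD.
  rewrite [leLHS]big_seq_cond [leRHS]big_seq_cond.
  rewrite [leLHS]big_mkcond [leRHS]big_mkcond /=; apply: ler_sum => a _.
  case aS: (a \in S) => //=; case ga: (has_good d M a); rewrite ?andbF ?andbT //.
  case: ifP => // ta.
  have /(mem_lipseq M v0 conn) la := aS.
  have [v [s H]] := range_dep conn reg d_gt0 expander_hull la ga.
  rewrite /F (bigD1 v) //= (bigD1 s) //= ht.
    by rewrite -addrA lerDl addr_ge0 ?sumr_ge0 // => w _; rewrite sumr_ge0.
  apply: (le_trans ta); move: H; rewrite -(ler_int R) => H; apply: le_trans H _.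
  by rewrite rmorphD /= -!pmulrn natrM.
rewrite [leLHS]big_mkcond [leRHS]big_mkcond /=; apply: ler_sum => a _.
by case: (t <= _); case: (has_good d M a).
Qed.

End Tails.

Local Open Scope classical_set_scope.
Local Open Scope ring_scope.

Theorem theorem1p2 (R : realType) :
  exists c C c' C' K : R,
    [/\ 0 < c, 0 < C, 0 < c', 0 < C' & 0 < K] /\
    forall (M n d : nat) (lambda : R) (G : sgraph),
      (0 < M)%N ->
      connected_graph G ->
      expander G n d lambda ->
      lambda <= d%:R / 5 ->
      d%:R / 5 <= c * n%:R ->
      M%:R <= Num.min (c * (d%:R `^ (3 / 2) / (lambda * log2 d%:R)))
                      (log2 n%:R `^ C) ->
    forall (v0 : G) (disp : measure_display) (Omega : measurableType disp)
           (P : probability Omega R) (f : Omega -> {ffun G -> int}),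
      uniformly_distributed P (Lip v0 M) f ->
      (P [set w | (C' * M%:R * (log2 (log2 n%:R) / log2 (d%:R / lambda))
                     + 2 * (M%:R + 1) <= (lip_range v0 (f w))%:~R)%R]
         <= (n%:R `^ (- c'))%:E)%E
      /\
      (forall v : G,
         ('V_P[fun w => ((f w v)%:~R)%R]
           <= (K * (M%:R *
                 (Num.max 1 (Num.ceil (log2 M%:R / log2 (d%:R / (2 * lambda)))))%:~R)
                 ^+ 2)%:E)%E).
Proof.
(* The order is c, C, c', C', K. The value 8 = 6 + 2 comes from 2jM <= 2(3x + 1)M <= 8xM for x >=
   1. *)
exists (expR (-2000)), 1, 1, 8, 7; split; first by split; rewrite ?expR_gt0.
move=> M n d lambda G M_gt0 conn expG lambda_le d_le.
rewrite le_min => /andP[M_le1 M_le2] v0 disp Omega P f uf.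
have cardG : #|G| = n by have [] := expG.
have reg : regular_graph G d by have [] := expG.
have dn := degree_lt_card v0 expG.
rewrite powRr1 in M_le2; last first.
  by rewrite /log2 divr_ge0 ?ln_ge0 ?ler1n // (leq_ltn_trans _ dn).
have d_gt0 : (0 < d)%N := ltnW (degree_gt1 M_gt0 lambda_le d_le M_le1 M_le2).
have lambda_gt0 := lambda_gt0 v0 M_gt0 expG lambda_le d_le M_le1 M_le2.
have Md := lipschitz_le_degree v0 M_gt0 expG lambda_le d_le M_le1 M_le2.
have q_small := unit_weight_bound v0 M_gt0 expG lambda_le d_le M_le1 M_le2.
have y_large := log2_card_ge v0 M_gt0 expG lambda_le d_le M_le1 M_le2.
have e_n := expR_n_small v0 M_gt0 expG lambda_le d_le M_le1 M_le2.
have n3 : 3 <= n%:R :> R.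
  by rewrite ler_nat; exact: leq_ltn_trans (degree_gt1 M_gt0 lambda_le d_le M_le1 M_le2) dn.
have n0 : 0 < n%:R :> R by lra.
have Mn : (M.+1 <= n)%N by apply: leq_ltn_trans dn.
have L0 : 0 < (size (lipseq M v0))%:R :> R := lipseq_gt0 R M v0 conn.
have hn : (M * n)%:R <= n%:R ^+ 2 :> R.
  by rewrite -natrX ler_nat -mulnn leq_mul2r (ltnW Mn) orbT.
have Mn' : M.+1%:R <= n%:R :> R by rewrite ler_nat.
split; last first.
  move=> v; apply: le_trans (uniform_variance_le uf (fun a => (a v)%:~R)) _.
  rewrite lee_fin ler_pdivrMr //.
  apply: le_trans (second_moment v0 expG lambda_gt0 lambda_le d_gt0 M_gt0 Md q_small conn v _) _.
    (* Since b <= n^2 and M + 1 <= n, the polynomial factor is at most n^8. *)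
    rewrite cardG -[leRHS](divff (lt0r_neq0 (exprn_gt0 8 n0))); apply: ler_pM => //.
    have -> : n%:R ^+ 8 = (n%:R ^+ 2) ^+ 3 * n%:R ^+ 2 :> R by ring.
    apply: ler_pM; rewrite ?exprn_ge0 ?ler0n //.
      by apply: lerXn2r hn; rewrite nnegrE ?exprn_ge0 ?ler0n.
    by rewrite expr2; nra.
  rewrite ler_wpM2r ?(ltW L0) // exprMn ler_wpM2l // ler_peMr ?exprn_ge0 ?ler0n //.
  by rewrite exprn_ege1 // ler1z le_max lexx.
set x := log2 (log2 n%:R) / log2 (d%:R / lambda).
set t := 8 * M%:R * x + 2 * (M%:R + 1).
rewrite (uniform_probability uf (fun a => t <= (lip_range v0 a)%:~R)) lee_fin.
rewrite powR_inv1 ?ler0n // ler_pdivrMr //.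
(* With tails n^(-4), the 2n pairs (v, s) and B <= nL give 2L / n^2; functions without a good
   translate add L / n^5, and n >= 3 brings the total below L / n. *)
have step h : (forall m : nat, t <= M.+1%:R + 2 * m%:R -> (h <= m)%N) ->
    (forall v s, #|[set g in balanced G d (M * #|G|) M | (h <= dep M g s v)%N]%SET|%:R
        <= #|balanced G d (M * #|G|) M|%:R * (n%:R ^+ 4)^-1 :> R) ->
    (count (fun a => t <= (lip_range v0 a)%:~R) (lipseq M v0))%:R
        <= n%:R^-1 * (size (lipseq M v0))%:R :> R.
  move=> ht hX; apply: le_trans (range_count v0 expG lambda_le d_gt0 conn ht) _.
  set l : R := (size (lipseq M v0))%:R in L0 *; set z : R := n%:R^-1.
  have z0 : 0 < z by rewrite invr_gt0.
  have zn : z * n%:R = 1 by rewrite mulVf ?lt0r_neq0.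
  have zE k : (n%:R ^+ k)^-1 = z ^+ k :> R by rewrite exprVn.
  have bad : (count (fun a => ~~ has_good d M a) (lipseq M v0))%:R <= l * z ^+ 5 :> R.
    apply: le_trans (bad_count v0 expG lambda_le d_gt0 Md q_small conn) _.
    rewrite -/l cardG; apply: (@le_trans _ _ (n%:R ^+ 2 * n%:R * l * z ^+ 8)).
      apply: ler_pM; rewrite ?expR_ge0 //; last by rewrite -zE.
        by rewrite !mulr_ge0 ?ler0n // ltW.
      by rewrite ler_wpM2r ?(ltW L0) //; apply: ler_pM; rewrite ?ler0n.
    have -> : n%:R ^+ 2 * n%:R * l * z ^+ 8 = l * z ^+ 5 * (z * n%:R) ^+ 3 by ring.
    by rewrite zn expr1n mulr1.
  have tails : \sum_(v : G) \sum_(s : bool)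
      #|[set g in balanced G d (M * #|G|) M | (h <= dep M g s v)%N]%SET|%:R <= l * (2 * z ^+ 2) :> R.
    apply: (@le_trans _ _ (\sum_(v : G) \sum_(s : bool) n%:R * l * z ^+ 4)).
      apply: ler_sum => v _; apply: ler_sum => s _; apply: le_trans (hX v s) _.
      rewrite zE ler_wpM2r ?exprn_ge0 ?(ltW z0) //.
      apply: le_trans (balanced_le M v0 expG lambda_le d_gt0 conn) _.
      by rewrite ler_wpM2r // ltW.
    rewrite !sumr_const card_bool -mulrnA -[leLHS]mulr_natr natrM [#|_|]cardG.
    have -> : n%:R * l * z ^+ 4 * (2 * n%:R) = l * (2 * z ^+ 2) * (z * n%:R) ^+ 2 by ring.
    by rewrite zn expr1n mulr1.
  apply: le_trans (lerD bad tails) _; rewrite -mulrDr mulrC ler_wpM2r ?(ltW L0) //.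
  have z3 : z <= 1 / 3 by rewrite /z -div1r ler_pM2l // lef_pV2 ?posrE.
  have z2 : z ^+ 2 <= z * (1 / 3) by rewrite expr2 ler_wpM2l // ltW.
  have z5 : z ^+ 5 <= z * (1 / 81).
    rewrite exprS ler_wpM2l ?(ltW z0) //.
    have -> : 1 / 81 = (1 / 3) ^+ 4 :> R by field.
    by apply: lerXn2r; rewrite ?nnegrE ?(ltW z0) // divr_ge0.
  by lra.
have x5 : 5 <= d%:R / lambda by rewrite ler_pdivlMr //; lra.
have ln2 : 0 < ln 2 :> R by rewrite ln_gt0 // ltr1n.
have ld : 0 < log2 (d%:R / lambda) by rewrite divr_gt0 // ln_gt0 //; lra.
have ly : 0 <= log2 (log2 (n%:R : R)) by apply: divr_ge0 (ltW ln2); rewrite ln_ge0 //; lra.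
have x0 : 0 <= x by apply: divr_ge0 (ltW ld).
have M1 : 1 <= M%:R :> R by rewrite ler1n.
have M0 : 0 < M.+1%:R :> R by rewrite ltr0n.
(* For x < 1 one has log n < d / lambda; the term 2(M + 1) of t forces depth above M / 2, where
   [dep_tail] gives exp(- d / 96). For x >= 1 the bound comes from neighbourhood growth over j > 3x
   steps. *)
have [x1|x1] := ltP x 1.
  apply: (step M./2.+1) => [m|v s].
    rewrite /t -natr1 => hm.
    have Mx : 0 <= M%:R * x by rewrite mulr_ge0.
    have : (M.+1 <= 2 * m)%N by rewrite -(ler_nat R) natrM -natr1; lra.
    exact: half_succ_le.
  apply: le_trans (dep_tail expG lambda_le d_gt0 q_small v s (ltn0Sn _)) _.
  rewrite ler_wpM2l ?ler0n //.
  have yd : log2 (n%:R : R) < d%:R / lambda.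
    have y0 : 0 < log2 (n%:R : R) by apply: (lt_le_trans _ y_large); rewrite ltr0n.
    have d0 : 0 < d%:R / lambda by apply: lt_le_trans x5.
    move: x1; rewrite /x; move: (log2 (n%:R : R)) y0 => y y0.
    by rewrite ltr_pdivrMr // mul1r /log2 ltr_pM2r ?invr_gt0 // ltr_ln ?posrE.
  apply: le_trans (expR_d_small v0 M_gt0 expG lambda_le d_le M_le1 M_le2 yd).
  rewrite ler_expR !mulNr lerN2 ler_pdivlMr; last by rewrite -natrM ltr0n.
  rewrite mulrAC ler_pdivrMr // -!natrM ler_nat.
  have /(leq_mul (leqnn (48 * d))) : (M.+1 <= 2 * M./2.+1)%N by exact: le_double_half_succ.
  by rewrite (_ : 48 * d * (2 * M./2.+1) = M./2.+1 * d * 96)%N; [rewrite mulnCA mulnA mulnAC|ring].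
pose j := (Num.truncn (3 * x)).+1.
have /andP[j1 j2] : (Num.truncn (3 * x))%:R <= 3 * x < j%:R.
  by apply: truncn_itv; rewrite mulr_ge0.
apply: (step (j * M).+1) => [m hm|v s].
  rewrite -(ltr_nat R) natrM; move: hm; rewrite /t /j -[M.+1%:R]natr1 -[_.+1%:R]natr1 => hm.
  have h1 : (Num.truncn (3 * x))%:R * M%:R <= 3 * x * M%:R by rewrite ler_wpM2r.
  have h2 : M%:R <= x * M%:R by rewrite ler_peMl.
  by lra.
apply: le_trans (deep_tail expG lambda_gt0 lambda_le d_gt0 q_small v s j) _.
rewrite ler_wpM2l ?ler0n //.
by have := expR_growth_small v0 M_gt0 expG lambda_le d_le M_le1 M_le2 (ltW j2).
Qed.
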